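(* Let $n\ge1$, let $n_1,n_2$ be integers with $0\le n_2<n_1\le n$, and let $\Omega\subset\mathbb{R}^n$ be a bounded convex domain. Assume $u:\Omega\to\mathbb{R}$ is a smooth strictly convex function satisfying, for all $x\in\Omega$, $$\ln q_{n_1,n_2}\left(D^2u(x)\right)=\frac{1}{2}\,x\cdot Du(x)-u(x).$$ Then $u$ is improper.
   Context: For a real symmetric $n\times n$ matrix $\mathcal{B}$ with eigenvalues $\lambda_1,\dots,\lambda_n$, $\sigma_l(\mathcal{B})=\sum_{i_1<\dots<i_l}\lambda_{i_1}\cdots\lambda_{i_l}$ for $1\le l\le n$ and $\sigma_0(\mathcal{B})=1$. The matrix $\mathcal{B}$ is called $k$-positive if $\sigma_l(\mathcal{B})>0$ for all $0\le l\le k$. For $0\le n_2<n_1\le n$ and an $n_1$-positive matrix $\mathcal{B}$, $q_{n_1,n_2}(\mathcal{B})=\sigma_{n_1}(\mathcal{B})/\sigma_{n_2}(\mathcal{B})$. $Du$ is the gradient and $D^2u$ the Hessian matrix of $u$. A domain is a nonempty connected open set. A smooth function $u$ is strictly convex if $D^2u(x)$ is positive-definite at every point $x$. A function $u:\Omega\to\mathbb{R}$ is proper if the preimage of every compact subset of $\mathbb{R}$ is a compact subset of $\Omega$; it is improper if it is not proper. *)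

(* Defs.v *)
(* Euclidean space R^n is 'rV[R]_n for R : realType; its library (sup) norm
   induces the usual topology and the usual bounded sets. *)
From HB Require Import structures.
From mathcomp Require Import all_boot all_order all_algebra.
From mathcomp Require Import all_classical all_reals all_analysis.
From mathcomp Require Import complex.

Set Implicit Arguments.
Unset Strict Implicit.
Unset Printing Implicit Defensive.
Import Order.TTheory GRing.Theory Num.Theory.
Import numFieldNormedType.Exports.
Local Open Scope classical_set_scope.
Local Open Scope ring_scope.

Section SymmetricMatrices.
Context {R : realType} {n : nat}.
Implicit Types B : 'M[R]_n.

(* The n eigenvalues of B listed with multiplicity, in a chosen order.  They
   are unspecified when the characteristic polynomial does not split over R;
   by eigenvaluesP this never happens for symmetric B. *)
Definition eigenvalues B : 'rV[R]_n :=
  [get lam : 'rV[R]_n | char_poly B = \prod_(i < n) ('X - (lam 0 i)%:P)].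

Definition sigma (l : nat) B : R :=
  \sum_(A : {set 'I_n} | #|A| == l) \prod_(i in A) eigenvalues B 0 i.

(* Meant for n1-positive B, where sigma n2 B > 0; positive definite matrices
   are n1-positive for every n1 <= n. *)
Definition q (n1 n2 : nat) B : R := sigma n1 B / sigma n2 B.

Definition posdefmx B : Prop :=
  B \is symmetricmx /\
  forall v : 'rV[R]_n, v != 0 -> 0 < (v *m B *m v^T) 0 0.

Lemma eigenvaluesP B : B \is symmetricmx ->
  char_poly B = \prod_(i < n) ('X - (eigenvalues B 0 i)%:P).
Proof.
move=> symB.
suff ex : exists lam : 'rV[R]_n,
    char_poly B = \prod_(i < n) ('X - (lam 0 i)%:P) by exact: (getPex ex).
pose f : {rmorphism R -> R[i]} := real_complex R.
pose BC := map_mx f B.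
have symBC : BC \is symmetricmx.
  apply/is_hermitianmxP; rewrite expr0 scale1r.
  move/is_hermitianmxP: symB; rewrite expr0 scale1r => symB.
  by rewrite /BC {1}symB; apply/matrixP => i j; rewrite !mxE.
have realBC : BC \is a realmx.
  by apply/mxOverP => i j; rewrite mxE; apply/complex_realP; exists (B i j).
have hermBC := realsym_hermsym symBC realBC.
have /orthomx_spectralP specBC := hermitian_normalmx hermBC.
have realD := hermitian_spectral_diag_real hermBC.
set P := spectralmx BC in specBC; set d := spectral_diag BC in specBC realD.
have uP : P \in unitmx by exact: spectral_unit.
pose lam : 'rV[R]_n := \row_i complex.Re (d 0 i).
have dE i : f (lam 0 i) = d 0 i.
  by rewrite mxE; apply: RRe_real; move/mxOverP: realD; apply.
exists lam; apply: (map_poly_inj f).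
rewrite map_char_poly rmorph_prod /= -/BC.
under eq_bigr do rewrite rmorphB /= map_polyX map_polyC /= dE.
have -> : char_poly BC = char_poly (diag_mx d).
  rewrite /char_poly /char_poly_mx [in LHS]specBC !map_mxM.
  have PP : map_mx polyC (invmx P) *m map_mx polyC P = 1%:M.
    by rewrite -map_mxM mulVmx // map_mx1.
  have XE : 'X%:M = map_mx polyC (invmx P) *m 'X%:M *m map_mx polyC P.
    by rewrite scalar_mxC -mulmxA PP mulmx1.
  rewrite [in LHS]XE -mulmxBl -mulmxBr !det_mulmx mulrAC -det_mulmx PP det1.
  by rewrite mul1r.
rewrite char_poly_trig ?diag_mx_is_trig //.
by apply: eq_bigr => i _; rewrite mxE eqxx.
Qed.

End SymmetricMatrices.

Section Calculus.
Context {R : realType} {n : nat}.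
Implicit Types (u : 'rV[R]_n -> R) (Omega : set 'rV[R]_n).

(* A function on an open set Omega is represented by a total function whose
   values off Omega are irrelevant: only its germs at points of Omega and its
   values on Omega are used below. *)

Definition partial (i : 'I_n) u : 'rV[R]_n -> R :=
  fun x => 'D_(delta_mx 0 i) u x.

Definition gradient u (x : 'rV[R]_n) : 'rV[R]_n := \row_i partial i u x.

Definition hessian u (x : 'rV[R]_n) : 'M[R]_n :=
  \matrix_(i, j) partial j (partial i u) x.

(* All iterated partial derivatives exist and are continuous on Omega. *)
Definition smooth_on Omega u : Prop :=
  forall (s : seq 'I_n) (x : 'rV[R]_n), Omega x ->
    {for x, continuous (foldr partial u s)} /\
    forall i : 'I_n, derivable (foldr partial u s) x (delta_mx 0 i).

Definition strictly_convex_on Omega u : Prop :=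
  forall x : 'rV[R]_n, Omega x -> posdefmx (hessian u x).

Definition domain Omega : Prop :=
  [/\ open Omega, connected Omega & Omega !=set0].

Definition proper_on Omega u : Prop :=
  forall K : set R, compact K -> compact (Omega `&` u @^-1` K).

Definition improper_on Omega u : Prop := ~ proper_on Omega u.

End Calculus.

(* Main.v *)
(* Put phi = x.Du/2 - u, so that ln q(D^2u) = phi, and let m = n1 - n2.  Suppose
   u is proper; then, u being convex on a bounded domain, its sublevel sets are
   compact.  Let p be a maximum point of (h - u) exp(phi / (2m)) on {u <= h}.
   Differentiating phi gives D phi = (H x - Du) / 2 with H = D^2u, and D^2 phi is
   half the derivative of H in the direction x.  At p the first-order condition
   makes H p a multiple of Du, so the Cauchy-Schwarz inequality for H bounds
   Du Du^T by a multiple of H, and the second-order condition bounds the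
   derivative of H in the direction p by kappa H.  Since q is monotone on positive
   definite matrices (Weyl's inequalities for the eigenvalues and Newton's
   inequalities for the elementary symmetric functions) and homogeneous of degree
   m, this yields p.D phi <= m kappa, which amounts to phi + u <= 2m at p.
   Comparing the maximum with the value at x, for h of the order of u(x), bounds
   phi above on the whole domain.  But 2 phi(t x) / t^3 is the derivative of
   u(t x) / t^2, so u stays bounded along a ray leaving the domain, which
   contradicts properness. *)

Require Import Defs.
From HB Require Import structures.
From mathcomp Require Import all_boot all_order all_algebra.
From mathcomp Require Import all_classical all_reals all_analysis.
From mathcomp Require Import perm ring lra.
Import Order.TTheory GRing.Theory Num.Theory.
Import numFieldNormedType.Exports.
Local Open Scope classical_set_scope.
Local Open Scope ring_scope.

(** * Elementary symmetric functions *)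

Section ElementarySymmetric.
Context {R : realType}.
Implicit Types (s t r : seq R) (P : {poly R}).

(** Generating polynomial of the elementary symmetric functions of [s]: the [k]-th one is the
    coefficient of degree [k], and one more entry means one more linear factor. *)
Definition esym_poly s : {poly R} := \prod_(x <- s) (1 + x *: 'X).

Lemma esym_poly_cons x s : esym_poly (x :: s) = esym_poly s * (1 + x *: 'X).
Proof. by rewrite /esym_poly big_cons mulrC. Qed.

Lemma coef_mul_1addZX P x k :
  (P * (1 + x *: 'X))`_k = P`_k + (if k is j.+1 then x * P`_j else 0).
Proof.
rewrite mulrDr mulr1 -scalerAr coefD coefZ coefMX.
by case: k => [|k] //=; rewrite mulr0.
Qed.

Lemma esym_poly_ge0 s k : all (>= 0) s -> 0 <= (esym_poly s)`_k.
Proof.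
elim: s k => [|x s IH] k /=.
  by rewrite /esym_poly big_nil coef1; case: eqP.
case/andP=> x0 s0; rewrite esym_poly_cons coef_mul_1addZX.
apply: addr_ge0; first exact: IH.
by case: k => // k; rewrite mulr_ge0// IH.
Qed.

Lemma esym_poly_gt0 s k : all (> 0) s -> (k <= size s)%N ->
  0 < (esym_poly s)`_k.
Proof.
elim: s k => [|x s IH] k /=.
  by rewrite leqn0 => _ /eqP ->; rewrite /esym_poly big_nil coef1.
case/andP=> x0 s0 ks; rewrite esym_poly_cons coef_mul_1addZX.
have s0' : all (>= 0) s by apply: sub_all s0 => y; exact: ltW.
case: k ks => [|k] ks; first by rewrite addr0 IH.
by rewrite ltr_wpDl ?esym_poly_ge0// mulr_gt0// IH.
Qed.

(** A form of Newton's inequalities without binomial weights. By induction on the list: the gap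
    between the two sides is a quadratic polynomial in the new entry [y], and its coefficients are
    nonnegative. *)
Lemma esym_poly_log_concave s i j : all (>= 0) s -> (i <= j)%N ->
  (esym_poly s)`_i * (esym_poly s)`_j.+1
  <= (esym_poly s)`_i.+1 * (esym_poly s)`_j.
Proof.
elim: s i j => [|y s IH] i j /=.
  by rewrite /esym_poly big_nil !coef1 /= mulr0 mul0r.
case/andP=> y0 s0 ij; rewrite esym_poly_cons !coef_mul_1addZX.
have P0 k := esym_poly_ge0 s k s0.
have LC a b := IH a b s0.
set P := esym_poly s in P0 LC *.
case: i j ij => [|i] [|j] //= ij.
- have := P0 0%N; have := P0 1%N; nra.
- have := LC 0%N j.+1 isT.
  have := mulr_ge0 (mulr_ge0 y0 (P0 0%N)) (mulr_ge0 y0 (P0 j)).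
  have := mulr_ge0 (P0 1%N) (mulr_ge0 y0 (P0 j)).
  nra.
- have h1 := LC i.+1 j.+1 ij; have h2 := LC i j ij.
  (* This is the coefficient of [y] in the gap: an equality if [i = j], otherwise two successive
     shifts of the indices. *)
  have h3 : P`_i * P`_j.+2 <= P`_i.+2 * P`_j.
    move: ij; rewrite ltnS leq_eqVlt => /orP[/eqP -> |ij].
      by rewrite mulrC.
    by apply: le_trans (LC i.+1 j ij); apply: LC; apply: leqW; apply: ltnW.
  have := ler_wpM2l (mulr_ge0 y0 y0) h2; have := ler_wpM2l y0 h3.
  nra.
Qed.

(** The gap is [y - x] times a log-concavity gap of the common entries [r]. Ratios are compared by
    cross-multiplication. *)
Lemma esym_ratio_le_step r x y k l : all (>= 0) r -> x <= y -> (l <= k)%N ->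
  (esym_poly (x :: r))`_k * (esym_poly (y :: r))`_l
  <= (esym_poly (y :: r))`_k * (esym_poly (x :: r))`_l.
Proof.
move=> r0 xy lk; rewrite !esym_poly_cons !coef_mul_1addZX.
case: l k lk => [|l] [|k] //=; rewrite ?addr0//.
- move=> _; rewrite ler_wpM2r ?esym_poly_ge0// lerD2l.
  by rewrite ler_wpM2r ?esym_poly_ge0.
- move=> lk; have := esym_poly_log_concave r l k r0 lk.
  rewrite -subr_ge0 => h; rewrite -subr_ge0 in xy.
  have := mulr_ge0 xy h; nra.
Qed.

(** The entries of [s] are replaced by those of [t] one at a time, each new entry joining [r]. The
    bound on [l] makes every denominator positive, so the comparisons chain. *)
Lemma esym_ratio_le r s t k l :
  all (> 0) r -> all (> 0) s -> all (> 0) t -> all2 <=%O s t ->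
  (l <= k)%N -> (l <= size r + size s)%N ->
  (esym_poly (r ++ s))`_k * (esym_poly (r ++ t))`_l
  <= (esym_poly (r ++ t))`_k * (esym_poly (r ++ s))`_l.
Proof.
elim: s t r => [|x s IH] [|y t] r //= r0 /andP[x0 s0] /andP[y0 t0]
  /andP[xy st] lk lrs.
have gt0 z u : 0 < z -> all (> 0) u -> size u = size s ->
    0 < (esym_poly (r ++ z :: u))`_l.
  move=> z0 u0 us; apply: esym_poly_gt0; first by rewrite all_cat r0/= z0.
  by rewrite size_cat/= us.
have rot z u : esym_poly (r ++ z :: u) = esym_poly (z :: (r ++ u)).
  by rewrite /esym_poly; apply: perm_big; rewrite perm_catC/= perm_cons perm_catC.
have rot' u : esym_poly (rcons r y ++ u) = esym_poly (r ++ y :: u).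
  by rewrite cat_rcons.
have s0' : all (>= 0) (r ++ s).
  by rewrite all_cat; apply/andP; split; [apply: sub_all r0|apply: sub_all s0] => z; exact: ltW.
have h1 := esym_ratio_le_step (r ++ s) x y k l s0' xy lk.
rewrite -!rot in h1.
have {IH} := IH t (rcons r y); rewrite all_rcons y0 /= !rot' => h2.
have {}h2 : (esym_poly (r ++ y :: s))`_k * (esym_poly (r ++ y :: t))`_l
  <= (esym_poly (r ++ y :: t))`_k * (esym_poly (r ++ y :: s))`_l.
  by apply: h2 => //; rewrite size_rcons addSnnS.
have bl := gt0 y s y0 s0 erefl.
have al := gt0 x s x0 s0 erefl.
have cl : 0 < (esym_poly (r ++ y :: t))`_l.
  by apply: gt0 => //; move: st; rewrite all2E => /andP[/eqP ->].
rewrite -(ler_pM2r bl).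
have := ler_wpM2r (ltW cl) h1; have := ler_wpM2r (ltW al) h2.
nra.
Qed.

(** Expanding the product amounts to choosing [d 0 i *: 'X] or [1] for each [i]; the subset [A]
    collects the indices of the first choice. *)
Lemma esymE n (d : 'rV[R]_n) l :
  \sum_(A : {set 'I_n} | #|A| == l) \prod_(i in A) d 0 i
  = (esym_poly [seq d 0 i | i <- enum 'I_n])`_l.
Proof.
rewrite /esym_poly big_map big_enum /=.
under [in RHS]eq_bigr do rewrite addrC.
rewrite bigA_distr coef_sum [in LHS]big_mkcond /=; apply: eq_bigr => A _.
rewrite [in RHS](bigID (mem A)) /= [in RHS](eq_bigr (fun i => d 0 i *: 'X)); last first.
  by move=> i ->.
rewrite [in RHS](big1 _ (fun i => i \notin A)) ?mulr1; last by move=> i /negbTE ->.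
rewrite scaler_prod prodr_const coefZ coefXn eq_sym.
by case: eqP => _; rewrite ?mulr1 ?mulr0.
Qed.

End ElementarySymmetric.

(** * The real spectral theorem *)

Section Spectral.
Context {R : realType}.

Lemma symmetricmxP n (B : 'M[R]_n) : reflect (B^T = B) (B \is symmetricmx).
Proof.
apply: (iffP (is_hermitianmxP _ _ _)); rewrite expr0 scale1r map_mx_id_in//.
Qed.

Lemma mulmx_trE n (v w : 'rV[R]_n) : (v *m w^T) 0 0 = \sum_i v 0 i * w 0 i.
Proof. by rewrite mxE; apply: eq_bigr => i _; rewrite mxE. Qed.

Lemma normsq_gt0 n (v : 'rV[R]_n) : v != 0 -> 0 < (v *m v^T) 0 0.
Proof.
rewrite mulmx_trE => v0; rewrite lt_neqAle sumr_ge0 ?andbT; last first.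
  by move=> i _; rewrite -expr2 sqr_ge0.
apply: contra v0 => /eqP/esym/eqP; rewrite psumr_eq0; last first.
  by move=> i _; rewrite -expr2 sqr_ge0.
move=> /allP v0; apply/eqP/rowP => i; rewrite mxE.
by have := v0 i (mem_index_enum i); rewrite /= mulf_eq0 orbb => /eqP.
Qed.

(** Serves to make a unit eigenvector the first row of an orthogonal matrix in [real_spectral]. *)
Lemma unit_row_completion n (v : 'rV[R]_n.+1) : v *m v^T = 1%:M ->
  exists2 Q : 'M[R]_n.+1, Q *m Q^T = 1%:M & row 0 Q = v.
Proof.
move=> v1; pose e : 'rV[R]_n.+1 := row 0 1%:M.
have e1 : e *m e^T = 1%:M.
  by rewrite /e tr_row trmx1 -row_mul mul1mx; apply/rowP => i; rewrite !ord1 !mxE.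
have [->|ve] := eqVneq v e; first by exists 1%:M; rewrite // trmx1 mulmx1.
(* Householder reflection in the hyperplane orthogonal to [v - e]. *)
pose w := v - e; pose N := (w *m w^T) 0 0.
have N0 : N != 0 by rewrite gt_eqF// normsq_gt0// subr_eq0.
have wN : w *m w^T = N%:M by rewrite [LHS]mx11_scalar.
pose s := (v *m e^T) 0 0.
have vs : v *m e^T = s%:M by rewrite [LHS]mx11_scalar.
have es : e *m v^T = s%:M.
  by rewrite -[LHS]trmxK trmx_mul trmxK vs tr_scalar_mx.
have NE : N = 2 - 2 * s.
  rewrite /N /w linearB /= mulmxBl !mulmxBr v1 e1 vs es !mxE eqxx !mulr1n; ring.
pose Q := 1%:M - (2 / N) *: (w^T *m w).
have QT : Q^T = Q.
  by rewrite /Q linearB /= linearZ /= trmx1 trmx_mul trmxK.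
exists Q.
  rewrite QT /Q; have : (w^T *m w) *m (w^T *m w) = N *: (w^T *m w).
    by rewrite mulmxA -(mulmxA w^T) wN mul_mx_scalar -scalemxAl.
  move: (w^T *m w) => W WW.
  rewrite mulmxBl !mulmxBr !mul1mx !mulmx1 -!scalemxAl -!scalemxAr WW !scalerA.
  have -> : 2 / N * (2 / N) * N = 2 / N + 2 / N by field.
  by rewrite scalerDl opprB addrK subrK.
have -> : row 0 Q = e *m Q by rewrite rowE /e rowE mulmx1.
have ew : e *m w^T = (s - 1)%:M by rewrite /w linearB /= mulmxBr es e1 -raddfB.
rewrite /Q mulmxBr mulmx1 -scalemxAr mulmxA ew mul_scalar_mx scalerA.
have -> : 2 / N * (s - 1) = -1 by rewrite NE; field; rewrite -NE.
by rewrite scaleN1r opprK /w addrCA subrr addr0.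
Qed.

(** Induction by deflation: [eigenvaluesP] provides a real eigenvalue, and conjugation by an
    orthogonal matrix whose first row is a unit eigenvector splits off a symmetric block of size
    [n]. *)
Lemma real_spectral n (A : 'M[R]_n) : A^T = A ->
  exists (O : 'M[R]_n) (d : 'rV[R]_n), O *m O^T = 1%:M /\ A = O^T *m diag_mx d *m O.
Proof.
elim: n A => [|n IH] A AT.
  by exists 1%:M, 0; split; apply/matrixP => -[].
have symA : A \is symmetricmx by apply/symmetricmxP.
have /eigenvalueP[v vA v0] : eigenvalue A (eigenvalues A 0 0).
  rewrite eigenvalue_root_char eigenvaluesP// big_ord_recl rootM.
  by rewrite root_XsubC eqxx.
set l := eigenvalues A 0 0 in vA.
have N0 := normsq_gt0 _ _ v0; set N := (v *m v^T) 0 0 in N0.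
pose v' := (Num.sqrt N)^-1 *: v.
have v'1 : v' *m v'^T = 1%:M.
  rewrite /v' linearZ /= -scalemxAl -scalemxAr scalerA [v *m _]mx11_scalar -/N.
  rewrite scale_scalar_mx -invfM -expr2 sqr_sqrtr ?ltW// mulVf// gt_eqF//.
have [Q QQ Qv] := unit_row_completion _ _ v'1.
have QQ' := mulmx1C QQ.
pose B : 'M[R]_(1 + n) := Q *m A *m Q^T.
have BT : B^T = B by rewrite /B !trmx_mul trmxK AT mulmxA.
have AB : A = Q^T *m B *m Q.
  by rewrite /B !mulmxA QQ' mul1mx -mulmxA QQ' mulmx1.
have rB : row 0 B = l *: row 0 1%:M.
  rewrite /B !row_mul Qv /v' -scalemxAl vA scalerA mulrC -scalerA -scalemxAl.
  by rewrite -/v' -Qv -row_mul QQ.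
have BE : B = block_mx l%:M 0 0 (drsubmx B).
  rewrite -[LHS]submxK; congr block_mx.
  - apply/matrixP => i j; rewrite !ord1 !mxE eqxx lshift0.
    by have /rowP/(_ 0) := rB; rewrite !mxE eqxx mulr1 => ->.
  - apply/matrixP => i j; rewrite !ord1 !mxE lshift0.
    by have /rowP/(_ (rshift 1 j)) := rB; rewrite !mxE mulr0 => ->.
  - apply/matrixP => i j; rewrite !ord1 -BT !mxE lshift0.
    by have /rowP/(_ (rshift 1 i)) := rB; rewrite !mxE mulr0 => ->.
have DT : (drsubmx B)^T = drsubmx B by rewrite trmx_drsub BT.
have [U' [d' [OO' dO']]] := IH _ DT.
pose K : 'M[R]_(1 + n) := block_mx 1%:M 0 0 U'.
have KT : K^T = block_mx 1%:M 0 0 U'^T by rewrite /K tr_block_mx trmx1 !trmx0.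
have KK : K *m K^T = 1%:M.
  rewrite KT mulmx_block !mul0mx !mulmx0 !addr0 !add0r mul1mx OO'.
  by rewrite -scalar_mx_block.
have KB : B = K^T *m diag_mx (row_mx l%:M d') *m K.
  rewrite BE KT diag_mx_row !mulmx_block.
  rewrite !mul0mx !mulmx0 !addr0 !add0r mul1mx mulmx1 -dO' {1}BE block_mxKdr.
  congr block_mx; rewrite ?mul0mx//; apply/matrixP => i j.
  by rewrite !ord1 !mxE eqxx.
exists (K *m Q), (row_mx l%:M d'); rewrite trmx_mul; split.
  by rewrite mulmxA -(mulmxA K) QQ mulmx1.
by rewrite [LHS]AB KB !mulmxA.
Qed.

End Spectral.

(** * Monotonicity of q *)

Section Weyl.
Context {R : realType} {n : nat}.
Implicit Types (A B O : 'M[R]_n) (d : 'rV[R]_n).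

Let prod_coords d : \prod_(x <- [seq d 0 i | i <- enum 'I_n]) ('X - x%:P) =
  \prod_(i < n) ('X - (d 0 i)%:P).
Proof. by rewrite big_map big_enum. Qed.

(** Unique factorization of the characteristic polynomial makes [d] a rearrangement of the chosen
    [eigenvalues], so any orthogonal diagonalization computes [sigma]. *)
Lemma sigma_spectral B O d l : O *m O^T = 1%:M -> B = O^T *m diag_mx d *m O ->
  sigma l B = (esym_poly [seq d 0 i | i <- enum 'I_n])`_l.
Proof.
move=> OO BE; have OO' := mulmx1C OO.
have symB : B \is symmetricmx.
  by apply/symmetricmxP; rewrite BE !trmx_mul trmxK tr_diag_mx mulmxA.
rewrite /sigma esymE; congr (polyseq _)`_l; apply: perm_big.
apply: prod_XsubC_eq; rewrite [LHS]prod_coords [RHS]prod_coords -eigenvaluesP//.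
rewrite /char_poly /char_poly_mx BE !map_mxM.
have PP : map_mx polyC O^T *m map_mx polyC O = 1%:M.
  by rewrite -map_mxM OO' map_mx1.
have XE : 'X%:M = map_mx polyC O^T *m 'X%:M *m map_mx polyC O.
  by rewrite scalar_mxC -mulmxA PP mulmx1.
rewrite [in LHS]XE -mulmxBl -mulmxBr !det_mulmx mulrAC -det_mulmx PP det1 mul1r.
rewrite -[\det _]/(char_poly (diag_mx d)) char_poly_trig ?diag_mx_is_trig//.
by apply: eq_bigr => i _; rewrite mxE eqxx.
Qed.

Lemma quadratic_spectral B O d (v : 'rV[R]_n) : B = O^T *m diag_mx d *m O ->
  (v *m B *m v^T) 0 0 = \sum_i d 0 i * (v *m O^T) 0 i ^+ 2.
Proof.
move=> ->; have -> : v *m (O^T *m diag_mx d *m O) *m v^T =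
    (v *m O^T) *m diag_mx d *m (v *m O^T)^T.
  by rewrite trmx_mul trmxK !mulmxA.
move: (v *m O^T) => w; rewrite mulmx_trE; apply: eq_bigr => i _.
rewrite mul_mx_diag mxE; ring.
Qed.

Lemma normsq_orthogonal O (v : 'rV[R]_n) : O *m O^T = 1%:M ->
  (v *m v^T) 0 0 = \sum_i (v *m O^T) 0 i ^+ 2.
Proof.
move=> /mulmx1C OO.
have -> : v *m v^T = (v *m O^T) *m (v *m O^T)^T.
  by rewrite trmx_mul trmxK mulmxA -(mulmxA v) OO mulmx1.
by rewrite mulmx_trE; apply: eq_bigr => i _; rewrite expr2.
Qed.

Lemma real_spectral_sorted B : B^T = B ->
  exists (O : 'M[R]_n) (d : 'rV[R]_n), [/\ O *m O^T = 1%:M,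
    B = O^T *m diag_mx d *m O &
    forall i j : 'I_n, (i <= j)%N -> d 0 j <= d 0 i].
Proof.
move=> BT; have [U [d [UU BE]]] := real_spectral n B BT.
pose s := [tuple d 0 i | i < n].
have /tuple_permP[p sp] : perm_eq (sort_tuple >=%O s) s by rewrite perm_sort.
exists (row_perm p U), (\row_i d 0 (p i)); split.
- apply/matrixP => i j; have /matrixP/(_ (p i) (p j)) := UU.
  rewrite !mxE (inj_eq perm_inj) => <-.
  by apply: eq_bigr => k _; rewrite !mxE.
- rewrite BE; apply/matrixP => i j; rewrite !mxE (reindex_inj (@perm_inj _ p)) /=.
  by apply: eq_bigr => k _; rewrite !mul_mx_diag !mxE.
- move=> i j ij; rewrite !mxE.
  have E k : d 0 (p k) = nth 0 (sort >=%O s) k.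
    have -> : sort >=%O s = [tuple tnth s (p i) | i < n] := sp.
    by rewrite -tnth_nth !tnth_mktuple.
  rewrite !E; have := sort_sorted (@ge_total _ R) s.
  move/(sorted_leq_nth (@ge_trans _ R) (@ge_refl _ R) 0); apply => //;
    by rewrite inE size_sort size_tuple.
Qed.

(* Courant-Fischer argument: a nonzero vector orthogonal to the first [k]
   eigenvectors of [B] and to the last [n - k - 1] ones of [A] separates the
   two [k]-th eigenvalues. *)
Lemma weyl_monotone A B OA OB dA dB :
  OA *m OA^T = 1%:M -> A = OA^T *m diag_mx dA *m OA ->
  OB *m OB^T = 1%:M -> B = OB^T *m diag_mx dB *m OB ->
  (forall i j : 'I_n, (i <= j)%N -> dA 0 j <= dA 0 i) ->
  (forall i j : 'I_n, (i <= j)%N -> dB 0 j <= dB 0 i) ->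
  (forall v : 'rV[R]_n, (v *m A *m v^T) 0 0 <= (v *m B *m v^T) 0 0) ->
  forall k, dA 0 k <= dB 0 k.
Proof.
move=> OOA AE OOB BE sA sB AB k.
(* Row [k] is zero, so [M] is singular, and a nonzero vector orthogonal to all its rows exists. *)
pose M : 'M[R]_n := \matrix_(i, j)
  if (i < k)%N then OB i j else if (k < i)%N then OA i j else 0.
have : \det M^T == 0.
  rewrite det_tr (expand_det_row _ k) big1// => j _.
  by rewrite !mxE ltnn mul0r.
move=> /det0P[v v0 vM].
have vB (i : 'I_n) : (i < k)%N -> (v *m OB^T) 0 i = 0.
  move=> ik; have -> : (v *m OB^T) 0 i = (v *m M^T) 0 i; last by rewrite vM mxE.
  by rewrite !mxE; apply: eq_bigr => j _; rewrite !mxE ik.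
have vA (i : 'I_n) : (k < i)%N -> (v *m OA^T) 0 i = 0.
  move=> ik; have -> : (v *m OA^T) 0 i = (v *m M^T) 0 i; last by rewrite vM mxE.
  by rewrite !mxE; apply: eq_bigr => j _; rewrite !mxE ltnNge (ltnW ik) ik.
have N0 := normsq_gt0 _ _ v0; rewrite -(ler_pM2r N0).
apply: le_trans (le_trans (AB v) _).
- rewrite (quadratic_spectral _ _ _ v AE) (normsq_orthogonal _ v OOA) mulr_sumr.
  apply: ler_sum => i _; case: (ltnP k i) => ki.
    by rewrite vA// expr0n/= !mulr0.
  by rewrite ler_wpM2r ?sqr_ge0// sA.
- rewrite (quadratic_spectral _ _ _ v BE) (normsq_orthogonal _ v OOB) mulr_sumr.
  apply: ler_sum => i _; case: (ltnP i k) => ki.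
    by rewrite vB// expr0n/= !mulr0.
  by rewrite ler_wpM2r ?sqr_ge0// sB.
Qed.

Lemma posdef_spectral_gt0 B O d : O *m O^T = 1%:M ->
  B = O^T *m diag_mx d *m O ->
  (forall v : 'rV[R]_n, v != 0 -> 0 < (v *m B *m v^T) 0 0) ->
  forall i, 0 < d 0 i.
Proof.
move=> OO BE Bpos i; pose v := row i O.
have vO : v *m O^T = row i 1%:M by rewrite /v -row_mul OO.
have : v != 0.
  apply/eqP => v0; move: vO; rewrite v0 mul0mx => /rowP/(_ i).
  by rewrite !mxE eqxx => /esym/eqP; rewrite oner_eq0.
move/Bpos; rewrite (quadratic_spectral _ _ _ v BE) vO (bigD1 i)//= big1 ?addr0.
  by rewrite !mxE eqxx expr1n mulr1.
by move=> j ji; rewrite !mxE eq_sym (negbTE ji) expr0n/= mulr0.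
Qed.

Lemma posdef_coercive B : posdefmx B ->
  exists2 c, 0 < c & forall v : 'rV[R]_n,
    c * (v *m v^T) 0 0 <= (v *m B *m v^T) 0 0.
Proof.
move=> [/symmetricmxP BT Bpos].
have [U [d [UU BE]]] := real_spectral n B BT.
have d0 := posdef_spectral_gt0 B U d UU BE Bpos.
(* The default [1] keeps the minimum positive even when [n] is zero. *)
exists (\big[Order.min/1]_i d 0 i).
  by elim/big_ind : _ => // x y x0 y0; rewrite lt_min x0 y0.
move=> v; rewrite (quadratic_spectral _ _ _ v BE) (normsq_orthogonal _ v UU) mulr_sumr.
by apply: ler_sum => i _; rewrite ler_wpM2r ?sqr_ge0// bigmin_le_cond.
Qed.

Lemma sigma_gt0 B l : posdefmx B -> (l <= n)%N -> 0 < sigma l B.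
Proof.
move=> [/symmetricmxP BT Bpos] ln.
have [U [d [UU BE]]] := real_spectral n B BT.
have d0 := posdef_spectral_gt0 B U d UU BE Bpos.
rewrite (sigma_spectral B U d)//; apply: esym_poly_gt0.
  by apply/allP => _ /mapP[i _ ->].
by rewrite size_map size_enum_ord.
Qed.

Lemma q_gt0 B n1 n2 : posdefmx B -> (n1 <= n)%N -> (n2 <= n)%N ->
  0 < q n1 n2 B.
Proof. by move=> Bp h1 h2; rewrite /q divr_gt0// sigma_gt0. Qed.

Lemma q_monotone A B n1 n2 : posdefmx A -> posdefmx B ->
  (n2 <= n1)%N -> (n1 <= n)%N ->
  (forall v : 'rV[R]_n, (v *m A *m v^T) 0 0 <= (v *m B *m v^T) 0 0) ->
  q n1 n2 A <= q n1 n2 B.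
Proof.
move=> Ap Bp n21 n1n AB.
have n2n := leq_trans n21 n1n.
rewrite /q ler_pdivrMr ?sigma_gt0// mulrAC ler_pdivlMr ?sigma_gt0//.
case: Ap Bp => [/symmetricmxP AT Apos] [/symmetricmxP BT Bpos].
have [U [a [UU AE sa]]] := real_spectral_sorted A AT.
have [V [b [VV BE sb]]] := real_spectral_sorted B BT.
have a0 := posdef_spectral_gt0 A U a UU AE Apos.
have b0 := posdef_spectral_gt0 B V b VV BE Bpos.
(* Sorting both spectra turns the comparison of quadratic forms into an entrywise one, as
   [esym_ratio_le] requires. *)
have ab := weyl_monotone A B U V a b UU AE VV BE sa sb AB.
rewrite !(sigma_spectral A U a)// !(sigma_spectral B V b)//.
rewrite -(cat0s [seq a 0 i | i <- _]) -(cat0s [seq b 0 i | i <- _]).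
apply: esym_ratio_le => //.
- by apply/allP => _ /mapP[i _ ->].
- by apply/allP => _ /mapP[i _ ->].
- by elim: (enum _) => //= i s ->; rewrite ab.
- by rewrite size_map size_enum_ord.
Qed.

Lemma q_homogeneous B n1 n2 c : posdefmx B -> 0 < c ->
  (n2 <= n1)%N -> q n1 n2 (c *: B) = c ^+ (n1 - n2) * q n1 n2 B.
Proof.
move=> [/symmetricmxP BT _] c0 n21.
have [U [d [UU BE]]] := real_spectral n B BT.
have S l : sigma l (c *: B) = c ^+ l * sigma l B.
  rewrite (sigma_spectral B U d)// (sigma_spectral (c *: B) U (c *: d))//.
    rewrite -!esymE mulr_sumr; apply: eq_bigr => J /eqP <-.
    under eq_bigr do rewrite mxE.
    by rewrite big_split /= prodr_const.
  by rewrite BE [diag_mx (c *: d)]linearZ -scalemxAr -scalemxAl.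
rewrite /q !S -{1}(subnK n21) exprD.
have cn : c ^+ n2 != 0 by rewrite expf_neq0// gt_eqF.
(* If the denominator vanishes, both quotients are zero, since the inverse of zero is zero. *)
have [->|s0] := eqVneq (sigma n2 B) 0; first by rewrite mulr0 !invr0 !mulr0.
by field; rewrite cn s0.
Qed.

End Weyl.

(** * Smooth functions *)

Section SmoothFunctions.
Context {R : realType} {n : nat}.
Implicit Types (f : 'rV[R]_n -> R) (x y v w h : 'rV[R]_n) (Omega : set 'rV[R]_n).

Lemma differentiable_of_bound (V W : normedModType R) (f : V -> W)
    (L : {linear V -> W}) (x : V) : continuous L ->
  (forall e, 0 < e ->
    \forall h \near (0 : V), `|f (h + x) - (f x + L h)| <= e * `|h|) ->
  differentiable f x.
Proof.
move=> Lc fL; have fE : f \o shift x = cst (f x) + L +o_ 0 id.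
  by apply/eqaddoP => e e0; exact: fL.
by apply/diff_locallyP; rewrite (diff_unique Lc fE).
Qed.

Lemma coord_le_norm v i : `|v 0 i| <= `|v|.
Proof.
rewrite [X in _ <= X]/Num.norm/= mx_normrE.
exact: (le_bigmax _ (fun k : 'I_1 * 'I_n => `|v k.1 k.2|) (0, i)).
Qed.

Lemma norm_le_coord v c : 0 <= c -> (forall i, `|v 0 i| <= c) -> `|v| <= c.
Proof.
move=> c0 vc; rewrite [X in X <= _]/Num.norm/= mx_normrE.
by apply/bigmax_leP; split => // -[i j] _ /=; rewrite ord1.
Qed.

(** Mean value theorem for both signs of [b] at once, since the coordinates of an increment may have
    either sign. *)
Lemma MVT_at0 (g dg : R -> R) (b : R) :
  (forall t : R, `|t| <= `|b| -> is_derive t 1 g (dg t)) ->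
  exists2 c, `|c| <= `|b| & g b - g 0 = dg c * b.
Proof.
move=> dgE.
have C (a c : R) : (forall t, t \in `[a, c] -> `|t| <= `|b|) ->
    {within `[a, c], continuous g}.
  move=> tb; apply: derivable_within_continuous => t /tb/dgE dgt.
  exact: (@ex_derive _ _ _ _ _ _ _ dgt).
have [b0|b0] := leP 0 b.
  have tb t : t \in `[0, b] -> `|t| <= `|b|.
    by rewrite in_itv /= => /andP[t0 tb]; rewrite !ger0_norm.
  have [c cb E] := @MVT_segment R g dg 0 b b0
    (fun t t0 => dgE t (tb t (subset_itv_oo_cc t0))) (C _ _ tb).
  by exists c; [exact: tb|rewrite E subr0].
have tb t : t \in `[b, 0] -> `|t| <= `|b|.
  rewrite in_itv /= => /andP[t0 t1].
  by rewrite !ler0_norm// ?lerN2// ltW.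
have [c cb E] := @MVT_segment R g dg b 0 (ltW b0)
  (fun t t0 => dgE t (tb t (subset_itv_oo_cc t0))) (C _ _ tb).
by exists c; [exact: tb|rewrite -opprB E sub0r mulrN opprK].
Qed.

Lemma is_derive_line f x v (t : R) :
  derivable f (x + t *: v) v ->
  is_derive t 1 (fun s : R => f (x + s *: v)) ('D_v f (x + t *: v)).
Proof.
move=> df.
have E : (fun s : R => s^-1 *: (((fun s : R => f (x + s *: v)) \o shift t) (s *: 1)
      - f (x + t *: v)))
    = (fun s : R => s^-1 *: ((f \o shift (x + t *: v)) (s *: v) - f (x + t *: v))).
  apply/funext => s /=; rewrite -[s%:A]/(s * 1) mulr1.
  by rewrite scalerDl addrCA.
by split; [rewrite /derivable E|rewrite /derive E].
Qed.

Lemma smooth_partial Omega f i : smooth_on Omega f -> smooth_on Omega (partial i f).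
Proof. by move=> sf s x Ox; have := sf (rcons s i) x Ox; rewrite foldr_rcons. Qed.

(** The truncations of [h] give the corners of a path from [x] to [x + h] that moves along one
    coordinate at a time. *)
Let trunc (k : nat) h : 'rV[R]_n := \row_j if (j < k)%N then h 0 j else 0.

(** Continuous partial derivatives give differentiability: the increment telescopes along the path
    of truncations, and the mean value theorem on each edge produces a partial derivative at a point
    near [x]. *)
Lemma smooth_differentiable Omega f x : open Omega -> smooth_on Omega f ->
  Omega x -> differentiable f x.
Proof.
move=> oO sf Ox.
pose d h : R := \sum_i h 0 i * partial i f x.
have dlin : linear d.
  move=> a u v; rewrite /d scaler_sumr -big_split; apply: eq_bigr => i _.
  by rewrite !mxE /= mulrDl -mulrA.
pose dM := GRing.isLinear.Build _ _ _ _ _ dlin.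
pose dL : {linear 'rV[R]_n -> R} := HB.pack d dM.
have dcont : continuous dL.
  move=> v; apply: (cvg_big add_continuous (nbhs_filter v)) => i _.
  by apply: cvgMr_tmp; exact: coord_continuous.
apply: (@differentiable_of_bound _ _ f dL x dcont) => e e0.
(* Each of the [n] edges contributes an error of at most [e' * |h|]; [n.+1] keeps the denominator
   nonzero. *)
pose e' := e / n.+1%:R.
have e'0 : 0 < e' by rewrite divr_gt0.
have close : \forall y \near x, Omega y /\
    forall i, `|partial i f x - partial i f y| < e'.
  apply: filterI; first exact: open_nbhs_nbhs.
  apply: (@filter_forall _ _ (fun i y => `|partial i f x - partial i f y| < e')
    (nbhs x) (nbhs_filter x)) => i.
  by have [+ _] := sf [:: i] x Ox => /cvgrPdist_lt; apply.
have [r r0 rP] : exists2 r, 0 < r & forall y, `|x - y| < r -> Omega y /\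
    forall i, `|partial i f x - partial i f y| < e'.
  by have /nbhs_normP[r /= r0 rP] := close; exists r.
near=> h.
have hr : `|h| < r by near: h; exact: (@nbhs0_lt R 'rV[R]_n r r0).
pose g k := f (x + trunc k h).
have g0 : g 0%N = f x by rewrite /g; congr f; apply/rowP => j; rewrite !mxE addr0.
have gn : g n = f (h + x).
  by rewrite /g addrC; congr f; apply/rowP => j; rewrite !mxE ltn_ord.
rewrite -gn opprD addrA -g0 /dL /= /d.
have -> : g n - g 0%N = \sum_(i < n) (g i.+1 - g i).
  by rewrite -(telescope_sumr _ (leq0n n)) big_mkord.
rewrite -sumrB.
apply: le_trans (_ : \sum_(i < n) e' * `|h| <= _); last first.
  rewrite sumr_const card_ord -mulr_natl mulrA ler_wpM2r//.
  by rewrite /e' mulrC -mulrA ger_pMr// mulrC ler_pdivrMr// mul1r ler_nat.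
apply: le_trans (ler_norm_sum _ _ _) _; apply: ler_sum => i _.
have step (t : R) : `|t| <= `|h 0 i| ->
    `|x - (x + trunc i h + t *: delta_mx 0 i)| < r.
  move=> th; apply: le_lt_trans hr; rewrite -addrA opprD addNKr normrN.
  apply: norm_le_coord => // j; rewrite !mxE /=.
  have [->|ji] := eqVneq j i.
    by rewrite ltnn add0r mulr1 (le_trans th)// coord_le_norm.
  by rewrite mulr0 addr0; case: ifP => _; rewrite ?normr0// coord_le_norm.
have [c ch E] := @MVT_at0 (fun s : R => f (x + trunc i h + s *: delta_mx 0 i))
  (fun s : R => partial i f (x + trunc i h + s *: delta_mx 0 i)) (h 0 i)
  (fun t th => is_derive_line _ _ _ _ ((sf [::] _ (rP _ (step t th)).1).2 i)).
have -> : g i.+1 = f (x + trunc i h + h 0 i *: delta_mx 0 i).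
  rewrite /g -addrA; congr (f (_ + _)); apply/rowP => j; rewrite !mxE /= ltnS.
  have [->|ji] := eqVneq j i; first by rewrite leqnn ltnn add0r mulr1.
  rewrite mulr0 addr0 leq_eqVlt (_ : (j == i :> nat) = false)//.
  exact/negbTE.
have -> : g i = f (x + trunc i h + 0 *: delta_mx 0 i) by rewrite scale0r addr0.
rewrite E mulrC -mulrBr normrM mulrC ler_pM// ?coord_le_norm//.
by rewrite distrC ltW//; exact: (rP _ (step c ch)).2.
Unshelve. all: by end_near. Qed.

Lemma derive_sum_partial f x v : differentiable f x ->
  'D_v f x = \sum_i v 0 i * partial i f x.
Proof.
move=> df; rewrite deriveE// {1}(row_sum_delta v) linear_sum /=.
by apply: eq_bigr => i _; rewrite linearZ /= /partial deriveE.
Qed.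

Lemma is_derive_line_partial f x v (t : R) : differentiable f (x + t *: v) ->
  is_derive t 1 (fun s : R => f (x + s *: v))
    (\sum_i v 0 i * partial i f (x + t *: v)).
Proof.
move=> df; rewrite -derive_sum_partial//.
exact/is_derive_line/diff_derivable.
Qed.

Lemma norm_delta_le1 (i : 'I_n) : `|delta_mx 0 i : 'rV[R]_n| <= 1.
Proof.
apply: norm_le_coord => // j; rewrite mxE eqxx /=.
by case: eqP => _; rewrite ?normr1 ?normr0.
Qed.

(** Two applications of the mean value theorem, first along [v] to the difference in the direction
    [w], then along [w] to the derivative along [v]. *)
Lemma mixed_difference f x v w (h : R) :
  (forall s t : R, `|s| <= `|h| -> `|t| <= `|h| ->
    derivable f (x + t *: w + s *: v) v /\
    derivable ('D_v f) (x + s *: v + t *: w) w) ->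
  exists c c', [/\ `|c| <= `|h|, `|c'| <= `|h| &
    (f (x + h *: w + h *: v) - f (x + h *: v)) - (f (x + h *: w) - f x)
    = 'D_w ('D_v f) (x + c *: v + c' *: w) * h * h].
Proof.
move=> df.
have F's (s : R) : `|s| <= `|h| ->
    is_derive s 1 (fun s : R => f (x + h *: w + s *: v) - f (x + s *: v))
      ('D_v f (x + h *: w + s *: v) - 'D_v f (x + s *: v)).
  move=> sh; apply: is_deriveB; apply: is_derive_line; first exact: (df s h sh _).1.
  by have := (df s 0 sh _).1; rewrite scale0r addr0; apply; rewrite normr0.
have [c ch Fc] := MVT_at0 _ _ _ F's.
have G't (t : R) : `|t| <= `|h| ->
    is_derive t 1 (fun t : R => 'D_v f (x + c *: v + t *: w))
      ('D_w ('D_v f) (x + c *: v + t *: w)).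
  by move=> th; apply: is_derive_line; exact: (df c t ch th).2.
have [c' c'h Gc] := MVT_at0 _ _ _ G't.
exists c, c'; split => //; move: Fc Gc; rewrite !scale0r !addr0 => ->.
by rewrite (addrAC x (h *: w)) => ->.
Qed.

(** Schwarz's theorem: the second difference is symmetric in the two directions, so the two mixed
    derivatives agree at some pair of points near [x], and continuity brings both points to [x]. *)
Lemma smooth_partialC Omega f x i j : open Omega -> smooth_on Omega f ->
  Omega x -> partial i (partial j f) x = partial j (partial i f) x.
Proof.
move=> oO sf Ox.
suff close e : 0 < e ->
    `|partial i (partial j f) x - partial j (partial i f) x| <= e + e.
  apply/eqP; rewrite -subr_eq0 -normr_le0; apply/ler_addgt0Pl => e e0.
  by rewrite addr0 {1}[e]splitr close// divr_gt0.
move=> e0; have [r r0 rP] : exists2 r, 0 < r & forall y, `|x - y| < r ->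
    [/\ Omega y, `|partial i (partial j f) x - partial i (partial j f) y| < e &
     `|partial j (partial i f) x - partial j (partial i f) y| < e].
  suff /nbhs_normP[r /= r0 rP] : \forall y \near x, [/\ Omega y,
      `|partial i (partial j f) x - partial i (partial j f) y| < e &
      `|partial j (partial i f) x - partial j (partial i f) y| < e].
    by exists r.
  have ij : \forall y \near x,
      `|partial i (partial j f) x - partial i (partial j f) y| < e.
    by have [+ _] := sf [:: i; j] x Ox => /cvgrPdist_lt; apply.
  have ji : \forall y \near x,
      `|partial j (partial i f) x - partial j (partial i f) y| < e.
    by have [+ _] := sf [:: j; i] x Ox => /cvgrPdist_lt; apply.
  have O : \forall y \near x, Omega y by exact: open_nbhs_nbhs.
  by apply: filterS3 O ij ji => y *; split.
(* Two displacements of length at most [h] stay within [r / 2] of [x]. *)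
pose h : R := r / 4; have h0 : 0 < h by rewrite divr_gt0.
have step k l (s t : R) : `|s| <= `|h| -> `|t| <= `|h| ->
    `|x - (x + s *: delta_mx 0 k + t *: delta_mx 0 l)| < r.
  move=> sh th; rewrite -addrA opprD addNKr normrN.
  apply: le_lt_trans (ler_normD _ _) _; rewrite !normrZ.
  have := ler_pM (normr_ge0 s) (normr_ge0 _) sh (norm_delta_le1 k).
  have := ler_pM (normr_ge0 t) (normr_ge0 _) th (norm_delta_le1 l).
  rewrite !mulr1 (gtr0_norm h0) => h1 h2.
  by apply: le_lt_trans (lerD h2 h1) _; rewrite /h; lra.
have mixed k l : exists c c', [/\ `|c| <= `|h|, `|c'| <= `|h| &
    (f (x + h *: delta_mx 0 l + h *: delta_mx 0 k) - f (x + h *: delta_mx 0 k))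
      - (f (x + h *: delta_mx 0 l) - f x)
    = partial l (partial k f) (x + c *: delta_mx 0 k + c' *: delta_mx 0 l) * h * h].
  apply: mixed_difference => s t sh th; split.
    by have [Oy _ _] := rP _ (step l k t s th sh); exact: (sf [::] _ Oy).2.
  by have [Oy _ _] := rP _ (step k l s t sh th); exact: (sf [:: k] _ Oy).2.
have [c [c' [ch ch' E]]] := mixed i j; have [d [d' [dh dh' F]]] := mixed j i.
have EF : partial j (partial i f) (x + c *: delta_mx 0 i + c' *: delta_mx 0 j)
    = partial i (partial j f) (x + d *: delta_mx 0 j + d' *: delta_mx 0 i).
  have hn0 : h != 0 by rewrite gt_eqF.
  apply: (mulIf hn0); apply: (mulIf hn0).
  have swap (y1 y2 y3 y4 : R) : (y1 - y2) - (y3 - y4) = (y1 - y3) - (y2 - y4) by ring.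
  apply: etrans (esym E) (etrans _ F); rewrite [LHS]swap; congr (f _ - _ - _).
  exact: addrAC.
have [_ _ h1] := rP _ (step i j c c' ch ch').
have [_ h2 _] := rP _ (step j i d d' dh dh').
rewrite EF in h1; apply: le_trans (ler_distD _ _ _) (lerD (ltW h2) _).
by rewrite distrC ltW.
Qed.

End SmoothFunctions.

(** * Derivatives of ln q along curves *)

Section OneVariable.
Context {R : realType}.
Implicit Types (g : R -> R).

Lemma is_derive_bound g (dg : R) : is_derive (0 : R) 1 g dg -> forall e, 0 < e ->
  exists2 r, 0 < r & forall t, `|t| < r -> `|g t - g 0 - t * dg| <= e * `|t|.
Proof.
move=> [dv <-] e e0; have /derivable_nbhs/eqaddoP/(_ e e0) := dv.
move=> /nbhs_normP[r /= r0 rP]; exists r => // t tr.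
have := rP t; rewrite /= sub0r normrN => /(_ tr).
by rewrite !fctE /= addr0 opprD addrA -[t%:A]/(t * 1) mulr1.
Qed.

(** If [W2] were positive, [W1] would be positive just to the right of [0], and [W] would exceed its
    maximum there by the mean value theorem. *)
Lemma second_derivative_test (W W1 : R -> R) (W2 r : R) : 0 < r ->
  (forall t : R, `|t| < r -> is_derive t 1 W (W1 t)) -> is_derive (0 : R) 1 W1 W2 ->
  (forall t, `|t| < r -> W t <= W 0) -> W1 0 = 0 /\ W2 <= 0.
Proof.
move=> r0 dW dW1 Wmax.
have itvr (t : R) : t \in `]-r, r[ -> `|t| < r.
  by rewrite in_itv /= -ltr_norml.
have n0r : `|0 : R| < r by rewrite normr0.
have W10 : W1 0 = 0.
  have H : is_derive (0 : R) 1 W 0.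
    apply: (@derive1_at_max R W (- r) r 0).
    - by apply: le_trans (ltW r0); rewrite oppr_le0 ltW.
    - by move=> t /itvr/dW [].
    - by rewrite in_itv /= oppr_lt0 r0.
    - by move=> t /itvr/Wmax.
  by have [_ <-] := dW 0 n0r; exact: derive_val.
split => //; rewrite leNgt; apply/negP => W20.
have [r' r'0 r'P] := is_derive_bound _ _ dW1 (W2 / 2) (divr_gt0 W20 (ltr0Sn _ 1)).
pose s := Num.min r r' / 2.
have s0 : 0 < s by rewrite divr_gt0// lt_min r0 r'0.
have sr : s < r by rewrite ltr_pdivrMr// gt_min; apply/orP; left; lra.
have sr' : s < r' by rewrite ltr_pdivrMr// gt_min; apply/orP; right; lra.
have [t||c] := @MVT R W W1 0 s s0.
- rewrite in_itv /= => /andP[t0 ts].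
  by apply: dW; rewrite gtr0_norm// (lt_trans ts).
- apply: derivable_within_continuous => t; rewrite in_itv /= => /andP[t0 ts].
  have tr : `|t| < r by rewrite ger0_norm// (le_lt_trans ts).
  by have [] := dW t tr.
rewrite in_itv /= => /andP[c0 cs] E.
have := Wmax s; rewrite gtr0_norm// => /(_ sr).
rewrite -subr_le0 E subr0 leNgt mulr_gt0//.
have := r'P c; rewrite gtr0_norm// => /(_ (lt_trans cs sr')).
rewrite W10 subr0 ler_distl => /andP[h _].
by apply: lt_le_trans h; nra.
Qed.

Lemma is_derive_big (V : normedModType R) n (h : 'I_n -> V -> R) x v dh :
  (forall i, is_derive x v (h i) (dh i)) ->
  is_derive x v (fun y => \sum_i h i y) (\sum_i dh i).
Proof.
move=> dhE; rewrite (_ : (fun y => _) = \sum_i h i); first exact: is_derive_sum.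
by apply/funext => y; rewrite fct_sumE.
Qed.

End OneVariable.

(** * Growth of ln q along a curve of matrices *)

Section LogQuotient.
Context {R : realType} {n : nat}.

Lemma quadraticE (B : 'M[R]_n) (v w : 'rV[R]_n) :
  (v *m B *m w^T) 0 0 = \sum_i \sum_j v 0 i * w 0 j * B i j.
Proof.
rewrite mulmx_trE exchange_big /=; apply: eq_bigr => j _.
by rewrite mxE mulr_suml; apply: eq_bigr => i _; ring.
Qed.

Lemma quadraticD (B C : 'M[R]_n) (v w : 'rV[R]_n) :
  (v *m (B + C) *m w^T) 0 0 = (v *m B *m w^T) 0 0 + (v *m C *m w^T) 0 0.
Proof. by rewrite mulmxDr mulmxDl [LHS]mxE. Qed.

Lemma quadraticZ a (B : 'M[R]_n) (v w : 'rV[R]_n) :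
  (v *m (a *: B) *m w^T) 0 0 = a * (v *m B *m w^T) 0 0.
Proof. by rewrite -scalemxAr -scalemxAl [LHS]mxE. Qed.

(** Each product of two coordinates is at most half the sum of their squares. *)
Lemma quadratic_le_entries (B : 'M[R]_n) (e : R) (v : 'rV[R]_n) :
  0 <= e -> (forall i j, `|B i j| <= e) ->
  (v *m B *m v^T) 0 0 <= e * n%:R * (v *m v^T) 0 0.
Proof.
move=> e0 Be; rewrite quadraticE mulmx_trE.
apply: le_trans (_ : \sum_i \sum_j (e / 2 * v 0 i ^+ 2 + e / 2 * v 0 j ^+ 2) <= _).
  apply: ler_sum => i _; apply: ler_sum => j _.
  apply: le_trans (ler_norm _) _; rewrite normrM.
  apply: le_trans (ler_wpM2l (normr_ge0 _) (Be i j)) _.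
  have h : `|v 0 i * v 0 j| <= (v 0 i ^+ 2 + v 0 j ^+ 2) / 2.
    have := sqr_ge0 (v 0 i + v 0 j); have := sqr_ge0 (v 0 i - v 0 j).
    by rewrite ler_norml => h1 h2; apply/andP; split; nra.
  by apply: le_trans (ler_wpM2r e0 h) _; lra.
under eq_bigr do rewrite big_split /= sumr_const card_ord -mulr_sumr.
rewrite big_split /= sumr_const card_ord sumrMnl -mulr_sumr -mulrnDl.
under [X in _ <= _ * X]eq_bigr do rewrite -expr2.
by rewrite -mulr_natr; lra.
Qed.

(* [A t] is compared with [(1 + (kappa + e) t) A 0], so that monotonicity and
   homogeneity of [q] replace its differentiability. *)
Lemma derive_ln_q_le (A : R -> 'M[R]_n) (D : 'M[R]_n) n1 n2 (kappa dq r : R) :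
  (n2 <= n1)%N -> (n1 <= n)%N -> 0 <= kappa -> 0 < r ->
  (forall t, `|t| < r -> posdefmx (A t)) ->
  (forall i j, is_derive (0 : R) 1 (fun t => A t i j) (D i j)) ->
  (forall v : 'rV[R]_n,
     (v *m D *m v^T) 0 0 <= kappa * (v *m A 0 *m v^T) 0 0) ->
  is_derive (0 : R) 1 (fun t => ln (q n1 n2 (A t))) dq ->
  dq <= (n1 - n2)%:R * kappa.
Proof.
move=> n21 n1n k0 r0 Apos dA Dle dlnq.
have A0pos : posdefmx (A 0) by apply: Apos; rewrite normr0.
have [c c0 cP] := posdef_coercive (A 0) A0pos.
apply/ler_addgt0Pl => e' e'0.
set m : R := (n1 - n2)%:R; have m0 : 0 <= m by exact: ler0n.
(* The final error is [e + m * e]: one [e] from the derivative of [ln q], and [m * e] from the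
   factor of homogeneity. *)
pose e : R := e' / (m + 1); have e0 : 0 < e by rewrite divr_gt0// ltr_wpDl.
have -> : e' = e + m * e by rewrite /e; field; rewrite gt_eqF// ltr_wpDl.
(* An entrywise error [eta * t] costs at most [n * eta * t] times the squared norm, which coercivity
   absorbs into [e * t] times the form of [A 0]. *)
pose eta : R := e * c / n.+1%:R.
have eta0 : 0 < eta by exact: (divr_gt0 (mulr_gt0 e0 c0) (ltr0Sn _ n)).
have [rq rq0 rqP] := is_derive_bound _ _ dlnq e e0.
have bnd i j := is_derive_bound _ _ (dA i j) eta eta0.
(* A common radius for the finitely many entries, taken as a minimum with default [1]. *)
pose rA : R := \big[Num.min/1]_i \big[Num.min/1]_j (s2val (cid2 (bnd i j))).
have rA0 : 0 < rA.
  apply: (big_ind (fun x : R => 0 < x)) => // [x y x0 y0|i _]; first by rewrite lt_min x0 y0.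
  apply: (big_ind (fun x : R => 0 < x)) => // [x y x0 y0|j _]; first by rewrite lt_min x0 y0.
  exact: (s2valP (cid2 (bnd i j))).
have rAP i j t : `|t| < rA -> `|A t i j - A 0 i j - t * D i j| <= eta * `|t|.
  move=> tr; apply: (s2valP' (cid2 (bnd i j))); apply: lt_le_trans tr _.
  by apply: le_trans (bigmin_le _ i _) _; exact: bigmin_le.
pose t := Num.min r (Num.min rq rA) / 2.
have mr0 : 0 < Num.min r (Num.min rq rA) by rewrite !lt_min r0 rq0.
have t0 : 0 < t by rewrite divr_gt0.
have tlt : t < Num.min r (Num.min rq rA) by rewrite /t; lra.
move: tlt; rewrite !lt_min => /and3P[tr trq trA].
have tn : `|t| = t by rewrite gtr0_norm.
have Atpos : posdefmx (A t) by apply: Apos; rewrite tn.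
pose s := 1 + (kappa + e) * t.
have s0 : 0 < s by rewrite /s ltr_wpDr// mulr_ge0 ?addr_ge0// ltW.
have sApos : posdefmx (s *: A 0).
  case: A0pos => [/symmetricmxP AT A0pos]; split.
    by apply/symmetricmxP; rewrite linearZ /= AT.
  by move=> v v0; rewrite quadraticZ mulr_gt0// A0pos.
have : q n1 n2 (A t) <= q n1 n2 (s *: A 0).
  apply: q_monotone => // v.
  rewrite (_ : A t = (A t - A 0 - t *: D) + (A 0 + t *: D)); last first.
    by rewrite (addrC (A 0)) addrA !subrK.
  rewrite quadraticD [X in _ + X]quadraticD !quadraticZ.
  have h1 : (v *m (A t - A 0 - t *: D) *m v^T) 0 0
      <= eta * t * n%:R * (v *m v^T) 0 0.
    apply: quadratic_le_entries; first by rewrite mulr_ge0 ?ltW.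
    by move=> i j; have := rAP i j t; rewrite tn !mxE => /(_ trA).
  have h2 := Dle v; have h3 := cP v.
  have N0 : 0 <= (v *m v^T) 0 0.
    by rewrite mulmx_trE sumr_ge0// => i _; rewrite -expr2 sqr_ge0.
  have etan : eta * n%:R <= e * c.
    rewrite /eta mulrAC ler_pdivrMr// ler_wpM2l ?ler_nat//.
    by rewrite ltW// mulr_gt0.
  have h4 := ler_wpM2r N0 etan; have h5 := ler_wpM2l (ltW e0) h3.
  have h6 : eta * t * n%:R * (v *m v^T) 0 0 <= t * (e * (v *m A 0 *m v^T) 0 0).
    have -> : eta * t * n%:R * (v *m v^T) 0 0 = t * (eta * n%:R * (v *m v^T) 0 0).
      by ring.
    by rewrite ler_pM2l//; lra.
  have h7 := ler_wpM2l (ltW t0) h2.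
  by rewrite /s; lra.
have n2n := leq_trans n21 n1n.
have qt0 := q_gt0 _ _ _ Atpos n1n n2n; have q00 := q_gt0 _ _ _ A0pos n1n n2n.
have qs0 : 0 < s ^+ (n1 - n2) * q n1 n2 (A 0) by exact: mulr_gt0 (exprn_gt0 _ s0) q00.
rewrite q_homogeneous// -ler_ln ?posrE//.
have lnE (y : R) : 0 < y -> ln (s ^+ (n1 - n2) * y) = m * ln s + ln y.
  by move=> y0; rewrite lnM ?posrE ?exprn_gt0// lnXn// -mulr_natl.
rewrite lnE// => h.
have := rqP t; rewrite tn => /(_ trq); rewrite ler_distl => /andP[h' _].
(* The inequality [1 + x <= expR x]. *)
have ls : ln s <= (kappa + e) * t.
  rewrite -ler_expR lnK ?posrE//; exact: expR_ge1Dx.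
have := ler_wpM2l m0 ls => h2.
by rewrite -(ler_pM2r t0); nra.
Qed.

End LogQuotient.

(** * The function phi *)

Section Phase.
Context {R : realType} {n : nat}.
Implicit Types (u f : 'rV[R]_n -> R) (x y p v w : 'rV[R]_n) (Omega : set 'rV[R]_n).

Let scalerE (a b : R) : a *: b = a * b. Proof. by []. Qed.

(** The function phi, that is, the right side of the equation. *)
Definition phase u x : R := 2^-1 * (\sum_i x 0 i * partial i u x) - u x.

(** Derivative of the Hessian at [p] in the direction of [p] itself, equal to twice the Hessian of
    phi. *)
Definition hessian_derivative u p : 'M[R]_n :=
  \matrix_(i, j) \sum_k p 0 k * partial k (partial j (partial i u)) p.

Lemma open_line Omega p v : open Omega -> Omega p ->
  exists2 r : R, 0 < r & forall t : R, `|t| < r -> Omega (p + t *: v).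
Proof.
move=> oO Op; have /nbhs_normP[e /= e0 eP] : nbhs p Omega by exact: open_nbhs_nbhs.
have v0 : 0 < `|v| + 1 by rewrite ltr_wpDl.
exists (e / (`|v| + 1)) => [|t]; first by rewrite divr_gt0.
rewrite ltr_pdivlMr// => te; apply: eP.
rewrite /= opprD addNKr normrN normrZ; apply: le_lt_trans te.
by rewrite ler_wpM2l// lerDl.
Qed.

Section Lines.
Context {Omega} {u} (oO : open Omega) (su : smooth_on Omega u).
Context {p v : 'rV[R]_n} {t : R} (Oy : Omega (p + t *: v)).

Lemma is_derive_smooth_line f : smooth_on Omega f ->
  is_derive t 1 (fun s : R => f (p + s *: v))
    (\sum_i v 0 i * partial i f (p + t *: v)).
Proof.
by move=> sf; apply: is_derive_line_partial; exact: (smooth_differentiable Omega).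
Qed.

Lemma is_derive_coord i : is_derive t 1 (fun s : R => (p + s *: v) 0 i) (v 0 i).
Proof.
rewrite (_ : (fun s : R => _) = cst (p 0 i) + (v 0 i) *: (id : R -> R)); last first.
  by apply/funext => s; rewrite !mxE !fctE /= mulrC.
have := is_deriveD (is_derive_cst (p 0 i) t 1) (is_deriveZ (v 0 i) (is_derive_id t 1)).
by rewrite add0r scalerE mulr1.
Qed.

Lemma is_derive_gradient_line :
  is_derive t 1 (fun s : R => \sum_i v 0 i * partial i u (p + s *: v))
    ((v *m hessian u (p + t *: v) *m v^T) 0 0).
Proof.
rewrite quadraticE.
rewrite (_ : \sum_i _ = \sum_i v 0 i *:
    \sum_j v 0 j * partial j (partial i u) (p + t *: v)); last first.
  apply: eq_bigr => i _; rewrite scaler_sumr; apply: eq_bigr => j _.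
  by rewrite mxE; exact/esym/mulrA.
apply: is_derive_big => i; apply: is_deriveZ.
exact/is_derive_smooth_line/smooth_partial.
Qed.

(** The product rule applied to [x.Du] also yields [Du.v]; half of it, minus the derivative of [u],
    leaves the term with coefficient -1/2. *)
Lemma is_derive_phase_line :
  is_derive t 1 (fun s : R => phase u (p + s *: v))
    (2^-1 * (((p + t *: v) *m hessian u (p + t *: v) *m v^T) 0 0
             - \sum_i v 0 i * partial i u (p + t *: v))).
Proof.
rewrite /phase; set y := p + t *: v.
have dx : is_derive t 1
    (fun s : R => \sum_i (p + s *: v) 0 i * partial i u (p + s *: v))
    (\sum_i (y 0 i *: (\sum_j v 0 j * partial j (partial i u) y)
      + partial i u y *: v 0 i)).
  apply: is_derive_big => i; apply: is_deriveM; first exact: is_derive_coord.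
  exact/is_derive_smooth_line/smooth_partial.
have := is_deriveB (is_deriveZ 2^-1 dx) (is_derive_smooth_line _ su).
congr is_derive.
rewrite big_split /= quadraticE [2^-1 *: _]scalerE.
rewrite (_ : \sum_i y 0 i *: _ = \sum_i \sum_j y 0 i * v 0 j * hessian u y i j).
  rewrite (_ : \sum_i partial i u y *: _ = \sum_i v 0 i * partial i u y).
    by rewrite -/y; lra.
  by apply: eq_bigr => i _; rewrite mulrC.
apply: eq_bigr => i _; rewrite scaler_sumr; apply: eq_bigr => j _.
by rewrite [hessian _ _ _ _]mxE; exact: mulrA.
Qed.

End Lines.

(** Schwarz's theorem twice. The inner exchange is needed on a neighbourhood of [p], since it is
    differentiated afterwards. *)
Lemma third_partialC Omega u p i j k : open Omega -> smooth_on Omega u ->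
  Omega p -> partial k (partial j (partial i u)) p
    = partial i (partial k (partial j u)) p.
Proof.
move=> oO su Op.
rewrite (@smooth_partialC _ _ _ (partial j u) p i k oO _ Op); last exact: smooth_partial.
apply: near_eq_derive; have : \forall y \near p, Omega y by exact: open_nbhs_nbhs.
by apply: filterS => y Oy; exact: smooth_partialC Oy.
Qed.

(** The two terms in [v H v] cancel; what remains is the third derivative applied to [p], [v], [v],
    rearranged by symmetry of third derivatives. *)
Lemma is_derive_phase_line2 Omega u p v : open Omega -> smooth_on Omega u ->
  Omega p ->
  is_derive (0 : R) 1
    (fun t : R => 2^-1 * (((p + t *: v) *m hessian u (p + t *: v) *m v^T) 0 0
             - \sum_i v 0 i * partial i u (p + t *: v)))
    (2^-1 * (v *m hessian_derivative u p *m v^T) 0 0).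
Proof.
move=> oO su Op; have Oy : Omega (p + (0 : R) *: v) by rewrite scale0r addr0.
have dij i j := is_derive_smooth_line oO Oy _
  (smooth_partial _ _ j (smooth_partial _ _ i su)).
have dq : is_derive (0 : R) 1
    (fun t : R => ((p + t *: v) *m hessian u (p + t *: v) *m v^T) 0 0)
    (\sum_i \sum_j v 0 j *: ((p + (0 : R) *: v) 0 i *:
      (\sum_k v 0 k * partial k (partial j (partial i u)) (p + (0 : R) *: v))
      + partial j (partial i u) (p + (0 : R) *: v) *: v 0 i)).
  rewrite (_ : (fun t : R => _) = fun t : R => \sum_i \sum_j v 0 j *:
    ((p + t *: v) 0 i * partial j (partial i u) (p + t *: v))).
    apply: is_derive_big => i; apply: is_derive_big => j; apply: is_deriveZ.
    exact: is_deriveM (is_derive_coord _) (dij i j).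
  apply/funext => t; rewrite quadraticE; apply: eq_bigr => i _.
  by apply: eq_bigr => j _; rewrite [hessian _ _ _ _]mxE !scalerE; ring.
have := is_deriveZ 2^-1 (is_deriveB dq (is_derive_gradient_line oO su Oy)).
congr is_derive; rewrite scale0r addr0 [LHS]scalerE; congr (_ * _).
rewrite !quadraticE.
pose T i j k := p 0 i * (v 0 j * (v 0 k * partial i (partial k (partial j u)) p)).
have -> : \sum_i \sum_j v 0 i * v 0 j * hessian_derivative u p i j
    = \sum_i \sum_j \sum_k T i j k.
  rewrite [RHS]exchange_big /=; apply: eq_bigr => j _.
  rewrite [RHS]exchange_big /=; apply: eq_bigr => k _.
  by rewrite mxE mulr_sumr; apply: eq_bigr => i _; rewrite /T; ring.
rewrite -sumrB; apply: eq_bigr => i _; rewrite -sumrB; apply: eq_bigr => j _.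
rewrite mxE (_ : \sum_k T i j k = v 0 j * (p 0 i *
    \sum_k v 0 k * partial k (partial j (partial i u)) p)).
  by rewrite !scalerE; ring.
rewrite mulr_sumr mulr_sumr; apply: eq_bigr => k _.
rewrite (third_partialC _ _ _ i j k oO su Op) /T.
by move: (partial i _ p) => X; ring.
Qed.

End Phase.

(** * Conditions at a maximum, and the Cauchy-Schwarz inequality *)

Section Maximum.
Context {R : realType}.

(** [U] and [P] stand for [u] and phi along a line. The derivative of the maximized function is
    [K * E] with [E > 0], so [K 0 = 0], and the second derivative at [0] reduces to [E 0] times the
    derivative of [K]. *)
Lemma max_sub_mul_exp (U U1 P P1 : R -> R) (U2 P2 h d r : R) : 0 < r ->
  (forall t : R, `|t| < r -> is_derive t 1 U (U1 t)) ->
  (forall t : R, `|t| < r -> is_derive t 1 P (P1 t)) ->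
  is_derive (0 : R) 1 U1 U2 -> is_derive (0 : R) 1 P1 P2 ->
  U 0 < h ->
  (forall t, `|t| < r -> (h - U t) * expR (d * P t) <= (h - U 0) * expR (d * P 0)) ->
  (h - U 0) * d * P1 0 = U1 0 /\
  (h - U 0) * d * P2 <= U2 + U1 0 ^+ 2 / (h - U 0).
Proof.
move=> r0 dU dP dU1 dP1 Uh Wmax.
have n0r : `|0 : R| < r by rewrite normr0.
pose E (t : R) := expR (d * P t).
have dE (t : R) : `|t| < r -> is_derive t 1 E (E t * (d * P1 t)).
  move=> tr; have := @is_derive1_comp R expR (fun s => d * P s) t _ _
    (is_derive_expR (d * P t)) (is_deriveZ d (dP t tr)).
  exact.
have dhU (t : R) : `|t| < r -> is_derive t 1 (fun s => h - U s) (- U1 t).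
  move=> tr; have := is_deriveB (is_derive_cst h t 1) (dU t tr).
  by rewrite sub0r.
pose K (t : R) := (h - U t) * (d * P1 t) - U1 t.
have dW (t : R) : `|t| < r ->
    is_derive t 1 (fun s => (h - U s) * E s) (K t * E t).
  move=> tr; have := is_deriveM (dhU t tr) (dE t tr).
  congr is_derive; rewrite -[LHS]/((h - U t) * (E t * (d * P1 t)) + E t * - U1 t).
  by rewrite /K; ring.
have dK : is_derive (0 : R) 1 K ((h - U 0) * (d * P2) + d * P1 0 * - U1 0 - U2).
  exact: (is_deriveB (is_deriveM (dhU 0 n0r) (is_deriveZ d dP1)) dU1).
have dKE := is_deriveM dK (dE 0 n0r).
have [KE0 W2] := second_derivative_test _ _ _ _ r0 dW dKE Wmax.
have E0 : 0 < E 0 by exact: expR_gt0.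
have K0 : K 0 = 0 by move/eqP: KE0; rewrite mulf_eq0 (gt_eqF E0) orbF => /eqP.
have hU : 0 < h - U 0 by rewrite subr_gt0.
have first : (h - U 0) * d * P1 0 = U1 0.
  by move: K0; rewrite /K => /eqP; rewrite subr_eq0 mulrA => /eqP.
split => //; move: W2.
rewrite K0 -[X in X <= _]/(0 * _ + E 0 * ((h - U 0) * (d * P2) + d * P1 0 * - U1 0 - U2)).
rewrite mul0r add0r pmulr_rle0// => W2.
have -> : U1 0 ^+ 2 / (h - U 0) = d * P1 0 * U1 0.
  by rewrite -first; field; rewrite gt_eqF.
by lra.
Qed.

Context {n : nat}.

Lemma bilinearDl (B : 'M[R]_n) (v v' w : 'rV[R]_n) :
  ((v + v') *m B *m w^T) 0 0 = (v *m B *m w^T) 0 0 + (v' *m B *m w^T) 0 0.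
Proof. by rewrite !mulmxDl [LHS]mxE. Qed.

Lemma bilinearZl a (B : 'M[R]_n) (v w : 'rV[R]_n) :
  ((a *: v) *m B *m w^T) 0 0 = a * (v *m B *m w^T) 0 0.
Proof. by rewrite -!scalemxAl [LHS]mxE. Qed.

Lemma bilinearDr (B : 'M[R]_n) (v w w' : 'rV[R]_n) :
  (v *m B *m (w + w')^T) 0 0 = (v *m B *m w^T) 0 0 + (v *m B *m w'^T) 0 0.
Proof. by rewrite linearD mulmxDr [LHS]mxE. Qed.

Lemma bilinearZr a (B : 'M[R]_n) (v w : 'rV[R]_n) :
  (v *m B *m (a *: w)^T) 0 0 = a * (v *m B *m w^T) 0 0.
Proof. by rewrite linearZ -scalemxAr [LHS]mxE. Qed.

Lemma posdef_cauchy_schwarz (B : 'M[R]_n) (v w : 'rV[R]_n) : posdefmx B ->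
  (w *m B *m v^T) 0 0 ^+ 2 <= (v *m B *m v^T) 0 0 * (w *m B *m w^T) 0 0.
Proof.
move=> [/symmetricmxP BT Bpos].
have [->|w0] := eqVneq w 0.
  by rewrite !mul0mx [X in X ^+ 2]mxE [X in _ * X]mxE expr0n mulr0.
have symB : (v *m B *m w^T) 0 0 = (w *m B *m v^T) 0 0.
  have -> : w *m B *m v^T = (v *m B *m w^T)^T by rewrite !trmx_mul trmxK BT mulmxA.
  by rewrite [RHS]mxE.
have w1 := Bpos w w0.
(* The value of [s] that minimizes the form at [v + s *: w]. *)
pose s := - (w *m B *m v^T) 0 0 / (w *m B *m w^T) 0 0.
have : 0 <= ((v + s *: w) *m B *m (v + s *: w)^T) 0 0.
  have [->|z0] := eqVneq (v + s *: w) 0; last exact/ltW/Bpos.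
  by rewrite !mul0mx mxE.
have -> : ((v + s *: w) *m B *m (v + s *: w)^T) 0 0 = (v *m B *m v^T) 0 0
    + 2 * s * (w *m B *m v^T) 0 0 + s ^+ 2 * (w *m B *m w^T) 0 0.
  rewrite !bilinearDl !bilinearDr !bilinearZl !bilinearZr symB.
  by move: (_ 0 0) (_ 0 0) (_ 0 0) => X Y Z; ring.
rewrite /s.
set a := (w *m B *m w^T) 0 0 in w1 *; set b := (w *m B *m v^T) 0 0.
set c := (v *m B *m v^T) 0 0 => h.
rewrite -ler_pdivrMr//; move: h.
have -> : c + 2 * (- b / a) * b + (- b / a) ^+ 2 * a = c - b ^+ 2 / a.
  by field; rewrite gt_eqF.
by rewrite subr_ge0.
Qed.

End Maximum.

(** * The estimate of phi at a maximum point *)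

Section Estimate.
Context {R : realType} {n n1 n2 : nat} {Omega : set 'rV[R]_n} {u : 'rV[R]_n -> R}.
Context (n21 : (n2 < n1)%N) (n1n : (n1 <= n)%N) (oO : open Omega)
  (su : smooth_on Omega u) (cu : strictly_convex_on Omega u)
  (u_eq : forall x, Omega x -> ln (q n1 n2 (hessian u x)) = phase u x).

Let m : R := (n1 - n2)%:R.

Lemma max_sub_mul_exp_phase (p : 'rV[R]_n) (h d : R) : Omega p -> u p < h ->
  (forall y, Omega y ->
    (h - u y) * expR (d * phase u y) <= (h - u p) * expR (d * phase u p)) ->
  forall v : 'rV[R]_n,
  (h - u p) * d * (2^-1 * ((p *m hessian u p *m v^T) 0 0
     - \sum_i v 0 i * partial i u p)) = \sum_i v 0 i * partial i u p /\
  (h - u p) * d * (2^-1 * (v *m hessian_derivative u p *m v^T) 0 0)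
    <= (v *m hessian u p *m v^T) 0 0
       + (\sum_i v 0 i * partial i u p) ^+ 2 / (h - u p).
Proof.
move=> Op uh pmax v; have [r r0 rP] := open_line _ p v oO Op.
have O0 : Omega (p + (0 : R) *: v) by rewrite scale0r addr0.
have := max_sub_mul_exp _ _ _ _ _ _ h d r r0
  (fun t tr => is_derive_smooth_line oO (rP t tr) u su)
  (fun t tr => is_derive_phase_line oO su (rP t tr))
  (is_derive_gradient_line oO su O0)
  (is_derive_phase_line2 _ _ _ v oO su Op).
rewrite scale0r addr0; apply => // t tr; exact/pmax/rP.
Qed.

Lemma phase_le_at_max (p : 'rV[R]_n) (h : R) : Omega p -> u p < h ->
  (forall y, Omega y ->
    (h - u y) * expR ((2 * m)^-1 * phase u y)
    <= (h - u p) * expR ((2 * m)^-1 * phase u p)) ->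
  phase u p <= 2 * m - u p.
Proof.
set d := (2 * m)^-1 => Op uh pmax.
have m1 : 1 <= m by rewrite /m ler1n subn_gt0.
have m0 : 0 < m := lt_le_trans ltr01 m1.
have d0 : 0 < d by rewrite invr_gt0 mulr_gt0.
have md : m * d = 2^-1 by rewrite /d; field; rewrite gt_eqF.
set a := h - u p; have a0 : 0 < a by rewrite subr_gt0.
have cond := max_sub_mul_exp_phase p h d Op uh pmax; rewrite -/a in cond.
set H := hessian u p in cond; pose g (v : 'rV[R]_n) : R := \sum_i v 0 i * partial i u p.
have Hpos : posdefmx H by exact: cu.
(* With this [c] the first-order condition reads [p H v = k Du.v] for [k = 1 + 2 * c]. *)
pose c := (a * d)^-1; have c0 : 0 < c by rewrite invr_gt0 mulr_gt0.
have adc : a * d * c = 1 by rewrite /c mulfV// gt_eqF// mulr_gt0.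
pose k := 1 + 2 * c; have k0 : 0 < k by rewrite /k; lra.
have grad (v : 'rV[R]_n) : (p *m H *m v^T) 0 0 = k * g v.
  have [h1 _] := cond v; rewrite -/(g v) in h1.
  have := congr1 (fun x => 2 * c * x) h1.
  have -> : 2 * c * (a * d * (2^-1 * ((p *m H *m v^T) 0 0 - g v)))
    = (a * d * c) * ((p *m H *m v^T) 0 0 - g v) by field.
  by rewrite adc mul1r /k; lra.
(* This is phi + u at [p], the quantity to be bounded by [2 * m]. *)
pose s := 2^-1 * g p.
have sE : s = phase u p + u p by rewrite /s /phase subrK.
have pHp : (p *m H *m p^T) 0 0 = 2 * k * s by rewrite grad /s; field.
have s0 : 0 <= s.
  have : 0 <= (p *m H *m p^T) 0 0.
    have [->|p0] := eqVneq p 0; first by rewrite !mul0mx mxE.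
    by case: Hpos => _ Hpos; apply/ltW/Hpos.
  by rewrite pHp pmulr_rge0// mulr_gt0.
(* The second-order condition bounds the derivative of [H] by [2 * c] times [H] plus the square of
   [Du] over [a]; Cauchy-Schwarz bounds that square by [2 * s / k] times [H]. *)
pose kappa := 2 * c * (1 + 2 * s / (a * k)).
have kappa0 : 0 <= kappa.
  apply: mulr_ge0; first by rewrite mulr_ge0// ltW.
  by apply: addr_ge0 => //; apply: divr_ge0; rewrite mulr_ge0// ltW.
have Dle (v : 'rV[R]_n) : (v *m hessian_derivative u p *m v^T) 0 0
    <= kappa * (v *m H *m v^T) 0 0.
  have CS := posdef_cauchy_schwarz H v p Hpos; rewrite grad pHp in CS.
  have [_ h2] := cond v; rewrite -/(g v) in h2.
  set V := (v *m H *m v^T) 0 0 in CS h2 *.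
  set D := (v *m hessian_derivative u p *m v^T) 0 0 in h2 *.
  have gV : g v ^+ 2 <= 2 * s / k * V.
    have -> : 2 * s / k * V = (V * (2 * k * s)) / k ^+ 2 by field; rewrite gt_eqF.
    by rewrite ler_pdivlMr ?exprn_gt0// -exprMn mulrC.
  have h3 : a * d * (2^-1 * D) <= V + 2 * s / k * V / a.
    by apply: le_trans h2 _; rewrite lerD2l ler_pM2r ?invr_gt0.
  have := ler_wpM2l (mulr_ge0 (ler0n _ 2) (ltW c0)) h3.
  have -> : 2 * c * (a * d * (2^-1 * D)) = (a * d * c) * D by field.
  rewrite adc mul1r => /le_trans; apply.
  rewrite le_eqVlt; apply/orP; left; apply/eqP; rewrite /kappa; field.
  by rewrite !gt_eqF.
have O0 : Omega (p + (0 : R) *: p) by rewrite scale0r addr0.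
have [r r0 rP] := open_line _ p p oO Op.
have dphase := is_derive_phase_line oO su O0.
(* The derivative of phi along [p] is half of [p H p - p.Du], hence half of [k - 1] times [g p]. *)
have dln : is_derive (0 : R) 1
    (fun t : R => ln (q n1 n2 (hessian u (p + t *: p)))) (c * g p).
  have -> : c * g p = 2^-1 * (((p + (0 : R) *: p) *m hessian u (p + (0 : R) *: p)
      *m p^T) 0 0 - \sum_i p 0 i * partial i u (p + (0 : R) *: p)).
    by rewrite scale0r addr0 grad -/(g p) /k; field.
  apply: near_eq_is_derive dphase; apply/nbhs_normP; exists r => // t.
  by rewrite /= sub0r normrN => tr; rewrite u_eq//; exact: rP.
have dH i j : is_derive (0 : R) 1 (fun t : R => hessian u (p + t *: p) i j)
    (hessian_derivative u p i j).
  rewrite mxE; have := is_derive_smooth_line oO O0 _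
    (smooth_partial _ _ j (smooth_partial _ _ i su)).
  rewrite scale0r addr0; congr is_derive; apply/funext => t; by rewrite mxE.
have := derive_ln_q_le (fun t => hessian u (p + t *: p)) (hessian_derivative u p)
  n1 n2 kappa (c * g p) r (ltnW n21) n1n kappa0 r0 (fun t tr => cu _ (rP t tr)) dH.
rewrite /= scale0r addr0 => /(_ Dle dln); rewrite -/m => main.
have gp : g p = 2 * s by rewrite /s; field.
have : s <= m * (1 + 2 * s / (a * k)).
  rewrite -(ler_pM2l (mulr_gt0 (ltr0Sn R 1) c0)).
  by move: main; rewrite gp /kappa; lra.
(* Here the exponent [d = 1 / (2 m)] matters: [a * k] is at least [4 * m], so the previous
   inequality becomes [s <= m + s / 2]. *)
have ak : a * k = a + 4 * m.
  rewrite /k /c /d; field; rewrite gt_eqF ?mulr_gt0//.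
  by rewrite !gt_eqF.
have akm : 4 * m <= a * k by rewrite ak; lra.
have : 2 * s / (a * k) <= s / (2 * m).
  rewrite ler_pdivrMr; last by rewrite ak; lra.
  have -> : 2 * s = s / (2 * m) * (4 * m) by field; rewrite gt_eqF.
  by rewrite ler_wpM2l// divr_ge0// mulr_ge0// ltW.
move=> h1 h2.
have h3 : m * (s / (2 * m)) = s / 2 by field; rewrite gt_eqF.
have := ler_wpM2l (ltW m0) h1; rewrite h3 => h4.
by move: sE; lra.
Qed.

End Estimate.

(** * Global bounds *)

Section Global.
Context {R : realType} {n : nat} {Omega : set 'rV[R]_n} {u : 'rV[R]_n -> R}.
Context (oO : open Omega) (su : smooth_on Omega u).

Lemma convex_segment (x y : 'rV[R]_n) (t : R) : convex_set Omega ->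
  Omega x -> Omega y -> 0 <= t <= 1 -> Omega (x + t *: (y - x)).
Proof.
move=> cO Ox Oy /andP[t0 t1].
have := cO y x (Itv01 t0 t1); rewrite !inE => /(_ Oy Ox).
congr Omega; rewrite -[LHS]/(t *: y + (1 - t) *: x) scalerBl scale1r scalerBr.
by rewrite addrCA.
Qed.

(** Two uses of the mean value theorem put [u] above its tangent plane at [x0], which is bounded
    below on a bounded set. Sublevel sets thus become preimages of compact segments. *)
Lemma convex_lower_bound : convex_set Omega -> bounded_set Omega ->
  Omega !=set0 -> strictly_convex_on Omega u ->
  exists lo, forall x, Omega x -> lo <= u x.
Proof.
move=> cO /pinfty_ex_gt0[M M0 MP] [x0 Ox0] cu.
exists (u x0 - \sum_i (M + M) * `|partial i u x0|) => x Ox.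
set v := x - x0.
have Ot (t : R) : 0 <= t <= 1 -> Omega (x0 + t *: v) by exact: convex_segment.
have cont (g g' : R -> R) (a b : R) : 0 <= a -> b <= 1 ->
    (forall t : R, 0 <= t <= 1 -> is_derive t 1 g (g' t)) ->
    {within `[a, b], continuous g}.
  move=> a0 b1 dg; apply: derivable_within_continuous => t.
  rewrite in_itv /= => /andP[at_ tb].
  have t01 : 0 <= t <= 1 by rewrite (le_trans a0)// (le_trans tb).
  by have [] := dg t t01.
pose U (t : R) : R := u (x0 + t *: v).
pose U1 (t : R) : R := \sum_i v 0 i * partial i u (x0 + t *: v).
pose U2 (t : R) : R := (v *m hessian u (x0 + t *: v) *m v^T) 0 0.
have dU (t : R) : 0 <= t <= 1 -> is_derive t 1 U (U1 t).
  by move=> t01; exact: (is_derive_smooth_line oO (Ot t t01) u su).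
have dU1 (t : R) : 0 <= t <= 1 -> is_derive t 1 U1 (U2 t).
  by move=> t01; exact: (is_derive_gradient_line oO su (Ot t t01)).
have [t||c c01] := @MVT_segment R U U1 0 1 ler01.
- by rewrite in_itv /= => /andP[t0 t1]; apply: dU; rewrite !ltW.
- exact: cont dU.
move: c01; rewrite in_itv /= => /andP[c0 c1].
have [t||e e01] := @MVT_segment R U1 U2 0 c c0.
- rewrite in_itv /= => /andP[t0 t1]; apply: dU1; rewrite ltW//=.
  by rewrite (le_trans _ c1)// ltW.
- exact: cont dU1.
move: e01; rewrite in_itv /= => /andP[e0 e1].
have Ux : U 1 = u x by rewrite /U scale1r addrC subrK.
rewrite Ux /U /U1 scale0r addr0 !subr0 mulr1 => EU1 EU.
have U2e : 0 <= U2 e.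
  have [v0|v0] := eqVneq v 0; first by rewrite /U2 v0 !mul0mx mxE.
  have [_ Hpos] : posdefmx (hessian u (x0 + e *: v)).
    by apply/cu/Ot; rewrite e0 (le_trans e1).
  exact/ltW/Hpos.
have := mulr_ge0 U2e c0; rewrite -EU1 -EU => main.
suff : - \sum_i (M + M) * `|partial i u x0| <= \sum_i v 0 i * partial i u x0 by lra.
rewrite -sumrN; apply: ler_sum => i _.
have : `|v 0 i * partial i u x0| <= (M + M) * `|partial i u x0|.
  rewrite normrM ler_wpM2r//; apply: le_trans (coord_le_norm _ _) _.
  by apply: le_trans (ler_normB _ _) _; rewrite lerD ?MP.
by rewrite ler_norml => /andP[].
Qed.

(** The derivative of [(u(s x0) + C) / s^2] is [2 (phi(s x0) - C) / s^3], hence nonpositive. *)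
Lemma ray_bound (x0 : 'rV[R]_n) (C t : R) : 1 <= t ->
  (forall s : R, 1 <= s <= t -> Omega (s *: x0)) ->
  (forall x, Omega x -> phase u x <= C) ->
  u (t *: x0) + C <= t ^+ 2 * (u x0 + C).
Proof.
move=> t1 Os Cb.
(* The base point [0] puts the ray in the form [p + s *: v] of the line lemmas. *)
pose P (s : R) := u (0 + s *: x0).
pose P1 (s : R) := \sum_i x0 0 i * partial i u (0 + s *: x0).
have dP (s : R) : 1 <= s <= t -> is_derive s 1 P (P1 s).
  move=> st; have Oy : Omega (0 + s *: x0) by rewrite add0r; exact: Os.
  exact: (is_derive_smooth_line oO Oy u su).
pose F (s : R) := (P s + C) * s^-1 ^+ 2.
pose F1 (s : R) := (P s + C) * (2 * s^-1 * (- s ^- 2)) + s^-1 ^+ 2 * (P1 s).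
have dF (s : R) : 1 <= s <= t -> is_derive s 1 F (F1 s).
  move=> st; have s0 : s != 0.
    by rewrite gt_eqF//; case/andP: st => s1 _; exact: lt_le_trans s1.
  have dV := is_deriveX 2 (@is_deriveV R id s 1 1 s0 (is_derive_id s 1)).
  have dF := is_deriveM (is_deriveD (dP s st) (is_derive_cst C s 1)) dV.
  have -> : F1 s = (P s + C) * ((2 * s^-1 ^+ 1) * (- s ^- 2 * 1))
      + s^-1 ^+ 2 * (P1 s + 0).
    by rewrite /F1; ring.
  exact: dF.
have [s||c c01] := @MVT_segment R F F1 1 t t1.
- by rewrite in_itv /= => /andP[s1 st]; apply: dF; rewrite !ltW.
- apply: derivable_within_continuous => s; rewrite in_itv /= => st.
  by have [] := dF s st.
have c1t : 1 <= c <= t by move: c01; rewrite in_itv.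
have c0 : 0 < c by case/andP: c1t => c1 _; exact: lt_le_trans c1.
have F1c : F1 c <= 0.
  have := Cb _ (Os c c1t).
  have -> : phase u (c *: x0) = 2^-1 * (c * P1 c) - P c.
    rewrite /phase /P1 /P add0r (_ : c * _ =
      \sum_i (c *: x0) 0 i * partial i u (c *: x0))//.
    by rewrite mulr_sumr; apply: eq_bigr => i _; rewrite mxE mulrA.
  have -> : F1 c = (2 * (2^-1 * (c * P1 c) - P c) - 2 * C) / c ^+ 3.
    by rewrite /F1; field; rewrite gt_eqF.
  by move=> h; rewrite pmulr_lle0 ?invr_gt0 ?exprn_gt0//; lra.
rewrite /F /P !add0r scale1r invr1 expr1n mulr1 => E.
have : (u (t *: x0) + C) * t^-1 ^+ 2 <= u x0 + C.
  by rewrite -subr_le0 E mulr_le0_ge0// subr_ge0.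
by rewrite exprVn ler_pdivrMr ?exprn_gt0 ?(lt_le_trans ltr01)// mulrC.
Qed.

Context {n1 n2 : nat} (n21 : (n2 < n1)%N) (n1n : (n1 <= n)%N)
  (cu : strictly_convex_on Omega u)
  (u_eq : forall x, Omega x -> ln (q n1 n2 (hessian u x)) = phase u x).

Lemma phase_upper_bound lo : (forall x, Omega x -> lo <= u x) ->
  proper_on Omega u -> exists2 C, 0 <= C & forall x, Omega x -> phase u x <= C.
Proof.
move=> ulo prop; pose m : R := (n1 - n2)%:R; pose d := (2 * m)^-1.
have d0 : 0 < d by rewrite invr_gt0 mulr_gt0 ?ltr0n ?subn_gt0.
exists (2 * expR (d * (2 * m - lo)) / d).
  by rewrite divr_ge0 ?mulr_ge0 ?expR_ge0// ltW.
(* This level makes [h - lo] at most twice [h - u x], so that the final bound does not depend on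
   [x]. *)
move=> x Ox; pose h := lo + 2 * (u x - lo) + 1.
have lx := ulo x Ox.
have cK := prop _ (@segment_compact R lo h).
pose W y := (h - u y) * expR (d * phase u y).
have ucont y : Omega y -> {for y, continuous u}.
  by move=> Oy; have [] := su [::] y Oy.
have pcont y : Omega y -> {for y, continuous (phase u)}.
  move=> Oy; have FF := nbhs_filter y; apply: (cvgB _ (ucont y Oy)).
  apply: cvgMl_tmp; apply: (cvg_big add_continuous FF) => i _.
  by apply: cvgM; [exact: coord_continuous|have [] := su [:: i] y Oy].
have Wcont : {within Omega `&` u @^-1` `[lo, h], continuous W}.
  apply: continuous_in_subspaceT => y; rewrite inE => -[Oy _].
  have FF := nbhs_filter y; apply: cvgM; first by apply: cvgB; [exact: cvg_cst|exact: ucont].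
  apply: continuous_cvg; first exact: continuous_expR.
  by apply: cvgMl_tmp; exact: pcont.
have Kx : (Omega `&` u @^-1` `[lo, h]) x.
  by split => //; rewrite /= in_itv /= lx /h; lra.
have [p] := compact_EVT_max (ex_intro _ x Kx) cK Wcont.
rewrite inE => -[Op /=]; rewrite in_itv /= => /andP[lp ph] Wmax.
have Wx := Wmax x; rewrite inE in Wx; have {}Wx := Wx Kx.
have hx : 0 < h - u x by rewrite /h; lra.
have Wx0 : 0 < W x by rewrite /W mulr_gt0// expR_gt0.
have up : u p < h.
  by have := lt_le_trans Wx0 Wx; rewrite /W pmulr_lgt0 ?expR_gt0// subr_gt0.
have pb : phase u p <= 2 * m - u p.
  apply: (phase_le_at_max n21 n1n oO su cu u_eq p h Op up) => y Oy.
  (* Outside the sublevel set the function is nonpositive, so the maximum over the compact set is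
     one over [Omega]. *)
  have [uy|uy] := leP (u y) h.
    by apply: Wmax; rewrite inE; split => //; rewrite /= in_itv /= ulo.
  apply: le_trans (_ : 0 <= _).
    by rewrite mulr_le0_ge0 ?expR_ge0// subr_le0 ltW.
  by rewrite mulr_ge0 ?expR_ge0// subr_ge0 ltW.
have Wp : W p <= (h - lo) * expR (d * (2 * m - lo)).
  rewrite /W ler_pM ?expR_ge0 ?subr_ge0//; first by lra.
  by rewrite ler_expR ler_pM2l//; lra.
have : (h - u x) * expR (d * phase u x) <= (h - u x) * (2 * expR (d * (2 * m - lo))).
  apply: le_trans Wx (le_trans Wp _); rewrite mulrA ler_wpM2r ?expR_ge0//.
  by rewrite /h; lra.
rewrite ler_pM2l// => h1.
(* The bound on the exponential is turned into one on phi by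
   [d * phi <= 1 + d * phi <= expR (d * phi)]. *)
rewrite ler_pdivlMr// mulrC; apply: le_trans h1.
by apply: le_trans (expR_ge1Dx _); rewrite lerDr.
Qed.

End Global.

(** * Rays leaving the domain, and the contradiction *)

Lemma open_nonzero_point (R : realType) (n : nat) (Omega : set 'rV[R]_n) :
  (1 <= n)%N -> open Omega -> Omega !=set0 -> exists2 x, Omega x & x != 0.
Proof.
case: n Omega => // n Omega _ oO [x Ox].
have [x0|x0] := eqVneq x 0; last by exists x.
have [r r0 rP] := open_line Omega x (delta_mx 0 0) oO Ox.
exists (x + (r / 2) *: delta_mx 0 0).
  by apply: rP; rewrite gtr0_norm ?divr_gt0//; lra.
apply/eqP => /rowP/(_ 0); rewrite x0 !mxE !eqxx mulr1 add0r => /eqP.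
by rewrite gt_eqF// divr_gt0.
Qed.

(** At the supremum of the admissible parameters the ray is still in the closed set [K], hence in
    [Omega], and openness prolongs it beyond the supremum. *)
Lemma ray_exit (R : realType) (n : nat) (Omega K : set 'rV[R]_n) (x : 'rV[R]_n) :
  open Omega -> bounded_set Omega -> Omega x -> x != 0 ->
  compact K -> K `<=` Omega ->
  ~ (forall t : R, 1 <= t -> Omega (t *: x) -> K (t *: x)).
Proof.
move=> oO /pinfty_ex_gt0[M M0 MP] Ox x0 cK KO ray.
have nx : 0 < `|x| by rewrite normr_gt0.
pose S := [set t : R | 1 <= t /\ Omega (t *: x)].
have supS : has_sup S.
  split; first by exists 1; split => //; rewrite scale1r.
  exists (M / `|x|) => t [t1 /MP]; rewrite /= normrZ ler_pdivlMr// => tM.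
  by apply: le_trans tM; rewrite ler_wpM2r// ler_norm.
have T1 : 1 <= sup S.
  by apply: sup_upper_bound => //; split => //; rewrite scale1r.
have KT : K (sup S *: x).
  have /closure_id -> := compact_closed (@norm_hausdorff R 'rV[R]_n) cK.
  move=> B /nbhs_normP[e /= e0 eB].
  have [t [t1 Ot] tS] := sup_adherent (divr_gt0 e0 nx) supS.
  exists (t *: x); split; first exact: ray.
  apply: eB; rewrite /= -scalerBl normrZ -ltr_pdivlMr// ger0_norm; first lra.
  by rewrite subr_ge0; apply: sup_upper_bound.
have [r r0 rP] := open_line Omega (sup S *: x) x oO (KO _ KT).
have Sr : S (sup S + r / 2).
  split; first by rewrite ler_wpDr// ltW// divr_gt0.
  by rewrite scalerDl; apply: rP; rewrite gtr0_norm ?divr_gt0//; lra.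
by have := sup_upper_bound supS Sr; rewrite gerDl leNgt divr_gt0.
Qed.

Theorem theorem1p5 (R : realType) (n : nat) (n_ge1 : (1 <= n)%N)
    (n1 n2 : nat) (n2_lt_n1 : (n2 < n1)%N) (n1_le_n : (n1 <= n)%N)
    (Omega : set 'rV[R]_n)
    (Omega_domain : domain Omega)
    (Omega_bounded : bounded_set Omega)
    (Omega_convex : convex_set Omega)
    (u : 'rV[R]_n -> R)
    (u_smooth : smooth_on Omega u)
    (u_convex : strictly_convex_on Omega u)
    (u_eq : forall x : 'rV[R]_n, Omega x ->
      ln (q n1 n2 (hessian u x)) =
        2^-1 * (\sum_(i < n) x 0 i * gradient u x 0 i) - u x) :
  improper_on Omega u.
Proof.
case: Omega_domain => oO _ O0 uprop.
have phaseE x : Omega x -> ln (q n1 n2 (hessian u x)) = phase u x.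
  move=> Ox; rewrite u_eq// /phase; congr (_ * _ - _).
  by apply: eq_bigr => i _; rewrite mxE.
have [lo ulo] := convex_lower_bound oO u_smooth Omega_convex Omega_bounded O0 u_convex.
have [C C0 phaseC] := phase_upper_bound oO u_smooth n2_lt_n1 n1_le_n u_convex
  phaseE lo ulo uprop.
have [x Ox x0] := open_nonzero_point R n Omega n_ge1 oO O0.
have /pinfty_ex_gt0[M M0 MP] := Omega_bounded.
(* The maximum makes [u x + C'] nonnegative, so that replacing [t] by its bound [M / |x|] in
   [ray_bound] only enlarges the right side. *)
pose C' := Num.max C (- u x); pose h := (M / `|x|) ^+ 2 * (u x + C') - C'.
have cK := uprop _ (@segment_compact R lo h).
apply: (ray_exit R n Omega _ x oO Omega_bounded Ox x0 cK); first exact: subIsetl.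
move=> t t1 Ot; split => //; rewrite /= in_itv /= ulo//=.
have tM : t <= M / `|x|.
  rewrite ler_pdivlMr ?normr_gt0//; have := MP _ Ot; rewrite /= normrZ.
  by apply: le_trans; rewrite ler_wpM2r// ler_norm.
have Os (s : R) : 1 <= s <= t -> Omega (s *: x).
  move=> /andP[s1 st].
  have := convex_segment x (t *: x) ((s - 1) / (t - 1)) Omega_convex Ox Ot.
  (* For [t = 1] the segment is a point and its parameter [(s - 1) / (t - 1)] has a zero
     denominator. *)
  have [t1'|t1'] := eqVneq t 1.
    by have -> : s = 1 by [apply/eqP; rewrite eq_le s1 -{1}t1' st]; rewrite scale1r.
  have t0 : 0 < t - 1 by rewrite subr_gt0 lt_neqAle eq_sym t1'.
  have -> : x + (s - 1) / (t - 1) *: (t *: x - x) = s *: x.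
    rewrite -{3}[x]scale1r -scalerBl scalerA mulfVK ?gt_eqF// scalerBl scale1r.
    by rewrite addrC subrK.
  apply; apply/andP; split; last by rewrite ler_pdivrMr// mul1r lerD2r.
  by apply: divr_ge0; [rewrite subr_ge0|exact: ltW].
have phaseC' y : Omega y -> phase u y <= C'.
  by move=> Oy; apply: le_trans (phaseC y Oy) _; rewrite le_max lexx.
have uC' : 0 <= u x + C'.
  have : - u x <= C' by rewrite le_max lexx orbT.
  by lra.
have := ray_bound oO u_smooth x C' t t1 Os phaseC'.
have : t ^+ 2 * (u x + C') <= (M / `|x|) ^+ 2 * (u x + C').
  have t0 : 0 <= t := le_trans ler01 t1.
  by rewrite ler_wpM2r// ler_pXn2r ?nnegrE// (le_trans t0).
by rewrite /h; lra.
Qed.
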